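(* Let $u:\mathbb{R}^2\to\mathbb{R}$ be a smooth solution of $\Delta u+e^{2u}=0$ in $\mathbb{R}^2$ and let $f(z)$ be its developing function. Then there exists a set $S\subset\mathbb{C}$ such that $\mathscr{H}^0(\mathbb{C}\setminus S)\le 5$ and such that for any point $A\in S$ we can find a point $P\in f^{-1}(\{A\})$ and a point $Q\in\mathbb{C}$ such that $d_g(P,Q)\ge\pi$, where $d_g$ is the distance function under the conformal metric $g=e^{2u}\delta$.
   Context: $\mathbb{R}^2$ is identified with $\mathbb{C}$ and $\delta$ is the Euclidean metric. By Liouville's formula, every entire solution $u$ of $\Delta u+e^{2u}=0$ in $\mathbb{R}^2$ has the form $u=\ln\frac{2|f'(z)|}{1+|f(z)|^2}$, where $f$ is a meromorphic function on $\mathbb{C}$ with only simple poles and with $f'$ nonvanishing; such $f$ is called the developing function of $u$. $\mathscr{H}^0$ is the $0$-dimensional Hausdorff measure, i.e. the counting measure. $d_g(P,Q)$ is the infimum of the lengths $\int_a^b e^{u(\gamma(t))}|\gamma'(t)|\,dt$ over piecewise smooth curves $\gamma:[a,b]\to\mathbb{C}$ from $P$ to $Q$. *)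

(* Defs.v *)
From Stdlib Require Import Reals List.
From Coquelicot Require Import Coquelicot.
Open Scope R_scope.

Definition smooth2 (u : C -> R) : Prop :=
  forall (n : nat) (x y : R), ex_diff_n (fun s t => u (s, t)) n x y.

Definition laplacian (u : C -> R) (z : C) : R :=
  partial_derive 2 0 (fun s t => u (s, t)) (fst z) (snd z)
  + partial_derive 0 2 (fun s t => u (s, t)) (fst z) (snd z).

(** Functions into the Riemann sphere are functions [f : C -> option C], where
    [None] is the point at infinity, so that a pole is never in the preimage of
    a finite value. *)

Definition finite_part (f : C -> option C) (z : C) : C :=
  match f z with Some w => w | None => RtoC 0 end.

Definition finite_differentiable (f : C -> option C) (z : C) : Prop :=
  f z <> None /\ ex_derive (K := C_AbsRing) (V := C_NormedModule) (finite_part f) z.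

Definition holomorphic_at (f : C -> option C) (z : C) : Prop :=
  locally z (finite_differentiable f).

Definition pole_at (f : C -> option C) (z : C) : Prop :=
  f z = None /\
  locally' z (finite_differentiable f) /\
  filterlim (fun w => Cmod (finite_part f w)) (locally' z) (Rbar_locally p_infty).

Definition meromorphic (f : C -> option C) : Prop :=
  forall z : C, holomorphic_at f z \/ pole_at f z.

Definition simple_pole_at (f : C -> option C) (z : C) : Prop :=
  pole_at f z /\
  exists c : C, c <> RtoC 0 /\
    filterlim (fun w : C => Cmult (Cminus w z) (finite_part f w))
      (locally' z) (locally c).

(** At a pole the right-hand side of Liouville's formula is understood as its
    continuous extension, so for continuous [u] it suffices to impose the
    formula off the poles. *)
Definition developing_function (u : C -> R) (f : C -> option C) : Prop :=
  meromorphic f /\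
  (forall z : C, pole_at f z -> simple_pole_at f z) /\
  (forall z : C, f z <> None -> C_derive (finite_part f) z <> RtoC 0) /\
  (forall z : C, f z <> None ->
     u z = ln (2 * Cmod (C_derive (finite_part f) z)
               / (1 + Cmod (finite_part f z) ^ 2))).

Definition smooth_curve (sigma : R -> C) : Prop :=
  forall (n : nat) (t : R),
    ex_derive_n (fun s => fst (sigma s)) n t /\
    ex_derive_n (fun s => snd (sigma s)) n t.

(** Each piece is smooth up to the endpoints of its closed interval; since
    consecutive pieces share a breakpoint, [gamma] is continuous on [[a, b]]. *)
Definition piecewise_smooth (gamma : R -> C) (a b : R) : Prop :=
  exists (n : nat) (tau : nat -> R),
    tau 0%nat = a /\ tau n = b /\
    forall i : nat, (i < n)%nat ->
      tau i < tau (S i) /\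
      exists sigma : R -> C, smooth_curve sigma /\
        forall t : R, tau i <= t <= tau (S i) -> gamma t = sigma t.

Definition speed (gamma : R -> C) (t : R) : R :=
  Cmod (Derive (fun s => fst (gamma s)) t, Derive (fun s => snd (gamma s)) t).

(** [speed] is unspecified at the finitely many breakpoints, which does not
    affect the integral. *)
Definition conformal_length (u : C -> R) (gamma : R -> C) (a b : R) : R :=
  RInt (fun t => exp (u (gamma t)) * speed gamma t) a b.

Definition conformal_dist (u : C -> R) (P Q : C) : R :=
  real (Glb_Rbar (fun L : R =>
    exists (gamma : R -> C) (a b : R),
      a < b /\ piecewise_smooth gamma a b /\ gamma a = P /\ gamma b = Q /\
      L = conformal_length u gamma a b)).

(** The counting measure, as the supremum of the cardinalities of the finite
    subsets of [E]. *)
Definition H0 (E : C -> Prop) : Rbar :=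
  Lub_Rbar (fun r : R =>
    exists l : list C, NoDup l /\ (forall z, In z l -> E z) /\ r = INR (length l)).

(* Main.v *)
Require Import Defs.
From Stdlib Require Import Reals List Lra Lia Psatz Classical ClassicalEpsilon.
From Coquelicot Require Import Coquelicot.
Open Scope R_scope.

(** The metric [e^{2u} |dz|^2] is the pull-back under [f] of the round metric of
    the unit sphere, so [f] does not increase lengths: if [f P = A] and [f Q] is
    the antipode [-1 / conj A] of [A], every curve from [P] to [Q] has length at
    least [PI].  Such [P] and [Q] exist unless [f] omits [A] or its antipode.
    By Picard's theorem [f] omits at most two finite values [a] and [b], so all
    exceptional [A] lie in [{0, a, b, -1/conj a, -1/conj b}]; the point [0] is
    in the list because its antipode is the point at infinity.

    Lengths ([length_ge_PI]).  Let [c] be the cosine of the spherical distance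
    from [A] to [f].  It is differentiable along smooth curves, also through the
    poles, where the chart [1/f] is used, and [|c'| <= sqrt (1 - c^2)] times the
    conformal speed.  As [acos] is not differentiable at [1] and [-1], which are
    the values of [c] at [P] and [Q], one measures [asin (kappa * c)] for
    [kappa < 1] instead, which is still 1-Lipschitz, and lets [kappa] tend to 1.

    Picard's theorem ([picard_three_values]).  If [f] omits the distinct finite
    values [a], [b], [c], then [1 / (f - c)] is entire, because the poles of [f]
    are simple, and an affine change of variable turns it into an entire [g]
    omitting [0] and [1].  The conformal metric of density
    [|g'| (1 + |g|^(1/3))^(1/2) (1 + |g-1|^(1/3))^(1/2) / (|g| |g-1|)^(5/6)]
    has curvature at most [- 1/720]: this is a lower bound for the Laplacian of
    the logarithm of the density.  Ahlfors' comparison with the hyperbolic metric of a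
    disc of radius [rho], which tends to [0] as [rho] grows, rules this out
    ([ahlfors_comparison]).  That [ln |g'|] is harmonic comes from the equation
    for [u]: up to a constant it is the sum of [u] and of the logarithm of an
    explicit positive function of [1 / (f - c)], and the Laplacian of this
    logarithm is [e^{2u}] ([jet_log_density]).

    Regularity.  The function [f] is only assumed complex differentiable, so
    Cauchy's theory has to be set up from Goursat's lemma.  In polar coordinates
    it gives at once the mean value property on circles ([mean_value]).  This is
    all that is needed of harmonicity when Laplacians are defined by circle means
    ([jet]): such Laplacians obey the chain rule for functions of one real
    variable and are nonpositive at a maximum.  Applied to difference quotients,
    the mean value property gives the continuity of the derivative
    ([derivative_continuous]), which extends Liouville's formula to the poles
    ([inv_chart_metric]). *)

Local Notation C_is_derive :=
  (is_derive (K := C_AbsRing) (V := C_NormedModule)).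

(** * Bisection of rectangles *)

Lemma pow_half_lt (e : R) : 0 < e -> exists n : nat, / 2 ^ n < e.
Proof.
  intros He.
  destruct (pow_lt_1_zero (/ 2)) with (y := e) as [N HN]; trivial.
  { rewrite Rabs_pos_eq; lra. }
  exists N. specialize (HN N (Nat.le_refl N)).
  rewrite <- pow_inv, <- (Rabs_pos_eq ((/ 2) ^ N)); trivial.
  apply pow_le; lra.
Qed.

Lemma nested_limit (a : nat -> R) (w : R) :
  0 <= w ->
  (forall n, a n <= a (S n) /\ a (S n) + w / 2 ^ S n <= a n + w / 2 ^ n) ->
  exists x, forall n, a n <= x <= a n + w / 2 ^ n.
Proof.
  intros Hw Ha.
  assert (Hp : forall n, 0 <= w / 2 ^ n).
  { intros n. apply Rmult_le_pos; trivial.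
    left; apply Rinv_0_lt_compat, pow_lt; lra. }
  assert (Hmono : forall n k, a n <= a (n + k)%nat /\
            a (n + k)%nat + w / 2 ^ (n + k) <= a n + w / 2 ^ n).
  { intros n k; induction k as [|k IH].
    - rewrite Nat.add_0_r; split; apply Rle_refl.
    - rewrite Nat.add_succ_r. destruct (Ha (n + k)%nat); lra. }
  destruct (ex_finite_lim_seq_incr a (a 0%nat + w / 2 ^ 0)) as [x Hx].
  - intros n; apply Ha.
  - intros n. destruct (Hmono 0%nat n) as [_ H]. rewrite Nat.add_0_l in H.
    generalize (Hp n); lra.
  - exists x; intros n.
    assert (Hx' : is_lim_seq (fun k => a (n + k)%nat) x).
    { apply is_lim_seq_ext with (fun k => a (k + n)%nat).
      - intros k; f_equal; lia.
      - apply (proj1 (is_lim_seq_incr_n a n x)); exact Hx. }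
    split.
    + refine (is_lim_seq_le (fun _ => a n) (fun k => a (n + k)%nat) (a n) x
               _ (is_lim_seq_const _) Hx').
      intros k; apply Hmono.
    + refine (is_lim_seq_le (fun k => a (n + k)%nat)
               (fun _ => a n + w / 2 ^ n) x (a n + w / 2 ^ n)
               _ Hx' (is_lim_seq_const _)).
      intros k; destruct (Hmono n k); generalize (Hp (n + k)%nat); lra.
Qed.

(** Compactness of rectangles in the form used for Goursat's lemma and for
    extrema: a property that passes from the four quarters to the whole, and
    holds for small rectangles of the same shape around each point, holds for the
    whole rectangle.  Otherwise there is a shrinking sequence of bad rectangles,
    and they contradict the local hypothesis at their common point.  All
    subrectangles keep the proportions of the original one, which is what makes
    their area comparable to the square of their diameter. *)
Lemma quartering (P : R -> R -> R -> R -> Prop) (A B C D : R) :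
  A <= B -> C <= D ->
  (forall a b c d, A <= a -> a <= b -> b <= B -> C <= c -> c <= d -> d <= D ->
     P a ((a + b) / 2) c ((c + d) / 2) -> P ((a + b) / 2) b c ((c + d) / 2) ->
     P a ((a + b) / 2) ((c + d) / 2) d -> P ((a + b) / 2) b ((c + d) / 2) d ->
     P a b c d) ->
  (forall x y, A <= x <= B -> C <= y <= D ->
     exists delta, 0 < delta /\ forall e a c, 0 < e < delta ->
       A <= a -> a <= x <= a + (B - A) * e -> a + (B - A) * e <= B ->
       C <= c -> c <= y <= c + (D - C) * e -> c + (D - C) * e <= D ->
       P a (a + (B - A) * e) c (c + (D - C) * e)) ->
  P A B C D.
Proof.
  intros HAB HCD Hsplit Hloc.
  set (w := B - A). set (h := D - C).
  set (Q := fun (n : nat) (p : R * R) =>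
    P (fst p) (fst p + w / 2 ^ n) (snd p) (snd p + h / 2 ^ n)).
  set (W := fun n : nat => w / 2 ^ S n). set (H := fun n : nat => h / 2 ^ S n).
  (* A bad quarter: the first one if there is one among the first three, and the
     last one otherwise. *)
  set (next := fun (n : nat) (p : R * R) =>
    let (a, c) := p in
    if excluded_middle_informative (~ Q (S n) (a, c)) then (a, c)
    else if excluded_middle_informative (~ Q (S n) (a + W n, c)) then (a + W n, c)
    else if excluded_middle_informative (~ Q (S n) (a, c + H n)) then (a, c + H n)
    else (a + W n, c + H n)).
  set (s := fix s n := match n with O => (A, C) | S n => next n (s n) end).
  assert (Hpow : forall n : nat, 0 < 2 ^ n) by (intros; apply pow_lt; lra).
  assert (Hw2 : forall n, w / 2 ^ n = 2 * W n).
  { intros n; unfold W; simpl; field; apply Rgt_not_eq, Hpow. }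
  assert (Hh2 : forall n, h / 2 ^ n = 2 * H n).
  { intros n; unfold H; simpl; field; apply Rgt_not_eq, Hpow. }
  assert (HW : forall n, 0 <= W n).
  { intros n; unfold W; apply Rmult_le_pos; [unfold w; lra|].
    left; apply Rinv_0_lt_compat, Hpow. }
  assert (HH : forall n, 0 <= H n).
  { intros n; unfold H; apply Rmult_le_pos; [unfold h; lra|].
    left; apply Rinv_0_lt_compat, Hpow. }
  assert (Hnext : forall n, (fst (s (S n)) = fst (s n) \/ fst (s (S n)) = fst (s n) + W n)
     /\ (snd (s (S n)) = snd (s n) \/ snd (s (S n)) = snd (s n) + H n)).
  { intros n; simpl. destruct (s n) as [a c]; simpl.
    repeat destruct excluded_middle_informative; simpl; auto. }
  assert (Hin : forall n, A <= fst (s n) /\ fst (s n) + w / 2 ^ n <= B /\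
                          C <= snd (s n) /\ snd (s n) + h / 2 ^ n <= D).
  { induction n as [|n IH]; [simpl; unfold w, h; lra|].
    change (w / 2 ^ S n) with (W n); change (h / 2 ^ S n) with (H n).
    rewrite Hw2, Hh2 in IH.
    generalize (Hnext n) (HW n) (HH n); lra. }
  apply NNPP; intros HP.
  assert (Hbad : forall n, ~ Q n (s n)).
  { induction n as [|n IH].
    { unfold Q; simpl. replace (A + w / 1) with B by (unfold w; field).
      replace (C + h / 1) with D by (unfold h; field). exact HP. }
    simpl. specialize (Hin n). rewrite Hw2, Hh2 in Hin.
    unfold Q in IH; rewrite Hw2, Hh2 in IH.
    destruct (s n) as [a c]; simpl in *.
    destruct excluded_middle_informative as [H1|H1]; trivial.
    destruct excluded_middle_informative as [H2|H2]; trivial.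
    destruct excluded_middle_informative as [H3|H3]; trivial.
    intros H4; apply IH. apply NNPP in H1, H2, H3.
    unfold Q in H1, H2, H3, H4; simpl fst in *; simpl snd in *.
    change (w / 2 ^ S n) with (W n) in *; change (h / 2 ^ S n) with (H n) in *.
    generalize (HW n) (HH n); intros.
    apply Hsplit; try lra;
      replace ((a + (a + 2 * W n)) / 2) with (a + W n) by field;
      replace ((c + (c + 2 * H n)) / 2) with (c + H n) by field;
      replace (a + 2 * W n) with (a + W n + W n) by ring;
      replace (c + 2 * H n) with (c + H n + H n) by ring; assumption. }
  destruct (nested_limit (fun n => fst (s n)) w) as [x Hx].
  { unfold w; lra. }
  { intros n. rewrite (Hw2 n); change (w / 2 ^ S n) with (W n).
    generalize (Hnext n) (HW n); lra. }
  destruct (nested_limit (fun n => snd (s n)) h) as [y Hy].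
  { unfold h; lra. }
  { intros n. rewrite (Hh2 n); change (h / 2 ^ S n) with (H n).
    generalize (Hnext n) (HH n); lra. }
  destruct (Hloc x y) as [delta [Hd Hl]].
  { generalize (Hin 0%nat) (Hx 0%nat); lra. }
  { generalize (Hin 0%nat) (Hy 0%nat); lra. }
  destruct (pow_half_lt delta Hd) as [n Hn].
  apply (Hbad n); unfold Q.
  generalize (Hin n) (Hx n) (Hy n); unfold Rdiv; fold w h in Hl |- *; intros.
  apply Hl; try lra. split; trivial. apply Rinv_0_lt_compat, Hpow.
Qed.

(** * Goursat's lemma for real closed forms *)

(** The integral of the form [P dx + Q dy] along the boundary. *)
Definition contour (P Q : R -> R -> R) (a b c d : R) : R :=
  RInt (fun x => P x c) a b - RInt (fun x => P x d) a b
  + (RInt (fun y => Q b y) c d - RInt (fun y => Q a y) c d).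


Lemma continuous_slices (F : R -> R -> R) (x y lx ly : R) :
  differentiable_pt_lim F x y lx ly ->
  continuous (fun t => F t y) x /\ continuous (fun t => F x t) y.
Proof.
  intros HF; split; apply (ex_derive_continuous (V := R_NormedModule)).
  - exists (lx * 1 + ly * 0). apply is_derive_Reals.
    apply (derivable_pt_lim_comp_2d F (fun t => t) (fun _ => y)); trivial.
    + apply derivable_pt_lim_id.
    + apply derivable_pt_lim_const.
  - exists (lx * 0 + ly * 1). apply is_derive_Reals.
    apply (derivable_pt_lim_comp_2d F (fun _ => x) (fun t => t)); trivial.
    + apply derivable_pt_lim_const.
    + apply derivable_pt_lim_id.
Qed.

Lemma ex_RInt_continuous_le (f : R -> R) (a b : R) :
  a <= b -> (forall x, a <= x <= b -> continuous f x) -> ex_RInt f a b.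
Proof.
  intros Hab Hf; apply (ex_RInt_continuous (V := R_CompleteNormedModule)).
  intros z Hz; rewrite Rmin_left, Rmax_right in Hz by lra; auto.
Qed.

Lemma RInt_split_mid (f : R -> R) (a b : R) :
  a <= b -> (forall x, a <= x <= b -> continuous f x) ->
  RInt f a b = RInt f a ((a + b) / 2) + RInt f ((a + b) / 2) b.
Proof.
  intros Hab Hf; symmetry; apply (RInt_Chasles f);
    apply ex_RInt_continuous_le; try lra; intros z Hz; apply Hf; lra.
Qed.

Lemma RInt_difference_close (f g : R -> R) (a b m e : R) :
  a <= b ->
  (forall x, a <= x <= b -> continuous f x) ->
  (forall x, a <= x <= b -> continuous g x) ->
  (forall x, a <= x <= b -> Rabs (f x - g x - m) <= e) ->
  Rabs (RInt f a b - RInt g a b - m * (b - a)) <= (b - a) * e.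
Proof.
  intros Hab Hf Hg He.
  assert (If : ex_RInt f a b).
  { apply ex_RInt_continuous_le; trivial. }
  assert (Ig : ex_RInt g a b).
  { apply ex_RInt_continuous_le; trivial. }
  assert (Ifg : ex_RInt (fun x => f x - g x) a b) by (apply (ex_RInt_minus f g); trivial).
  assert (E : RInt (fun x => f x - g x - m) a b = RInt f a b - RInt g a b - m * (b - a)).
  { rewrite (RInt_minus (fun x => f x - g x) (fun _ => m)), (RInt_minus f g), RInt_const;
      trivial.
    - unfold minus, plus, opp, scal; simpl; unfold mult; simpl; ring.
    - apply ex_RInt_const. }
  rewrite <- E. apply abs_RInt_le_const; trivial.
  apply (ex_RInt_minus (fun x => f x - g x) (fun _ => m)); trivial.
  apply ex_RInt_const.
Qed.

(** A closed form whose coefficients are merely differentiable integrates to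
    zero: over a rectangle of scale [e] the affine parts contribute nothing and the
    remainders contribute [o (e^2)], that is, [o] of the area, a bound which is
    additive under subdivision. *)
Lemma goursat (P Q : R -> R -> R) (A B C D : R) :
  A < B -> C < D ->
  (forall x y, A <= x <= B -> C <= y <= D ->
     exists p k q, differentiable_pt_lim P x y p k /\
                   differentiable_pt_lim Q x y k q) ->
  contour P Q A B C D = 0.
Proof.
  intros HAB HCD Hd.
  assert (HPx : forall x y, A <= x <= B -> C <= y <= D ->
            continuous (fun t => P t y) x).
  { intros x y Hx Hy; destruct (Hd x y Hx Hy) as (p & k & q & H & _).
    eapply continuous_slices; exact H. }
  assert (HQy : forall x y, A <= x <= B -> C <= y <= D ->
            continuous (fun t => Q x t) y).
  { intros x y Hx Hy; destruct (Hd x y Hx Hy) as (p & k & q & _ & H).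
    eapply continuous_slices; exact H. }
  assert (Heps : forall eps, 0 < eps ->
    Rabs (contour P Q A B C D) <= eps * ((B - A) * (D - C))).
  { intros eps Heps.
    apply (quartering (fun a b c d =>
      Rabs (contour P Q a b c d) <= eps * ((b - a) * (d - c)))); [lra | lra | |].
    { intros a b c d H1 H2 H3 H4 H5 H6 I1 I2 I3 I4.
      replace (contour P Q a b c d) with
        (contour P Q a ((a + b) / 2) c ((c + d) / 2)
         + contour P Q ((a + b) / 2) b c ((c + d) / 2)
         + contour P Q a ((a + b) / 2) ((c + d) / 2) d
         + contour P Q ((a + b) / 2) b ((c + d) / 2) d).
      - eapply Rle_trans; [apply Rabs_triang|].
        eapply Rle_trans; [apply Rplus_le_compat_r, Rabs_triang|].
        eapply Rle_trans; [do 2 apply Rplus_le_compat_r; apply Rabs_triang|].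
        lra.
      - unfold contour.
        rewrite (RInt_split_mid (fun x => P x c) a b),
          (RInt_split_mid (fun x => P x d) a b),
          (RInt_split_mid (fun y => Q a y) c d),
          (RInt_split_mid (fun y => Q b y) c d);
          trivial; try (intros; first [apply HPx | apply HQy]; lra).
        ring. }
    intros x y Hx Hy.
    destruct (Hd x y Hx Hy) as (p & k & q & HP & HQ).
    set (w := B - A). set (h := D - C).
    assert (Hw : 0 < w) by (unfold w; lra). assert (Hh : 0 < h) by (unfold h; lra).
    (* The error [2 e1 (e (w + h))^2] is then [eps] times the area [e^2 w h]. *)
    set (e1 := eps * (w * h) / (2 * (w + h) * (w + h))).
    assert (He1 : 0 < e1).
    { unfold e1; apply Rdiv_lt_0_compat; [|nra].
      apply Rmult_lt_0_compat; trivial; nra. }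
    destruct (HP (mkposreal e1 He1)) as [[d1 Hd1] HP1].
    destruct (HQ (mkposreal e1 He1)) as [[d2 Hd2] HQ1].
    simpl in HP1, HQ1.
    exists (Rmin d1 d2 / (w + h)); split.
    { apply Rdiv_lt_0_compat; [apply Rmin_glb_lt; trivial | lra]. }
    intros e a c [He He'] Ha Hxa Hb Hc Hyc Hdd.
    fold w h in Hxa, Hb, Hyc, Hdd |- *.
    assert (Hs : e * (w + h) < Rmin d1 d2).
    { apply Rmult_lt_compat_r with (r := w + h) in He'; [|lra].
      unfold Rdiv in He'; rewrite Rmult_assoc, Rinv_l, Rmult_1_r in He'; lra. }
    assert (Hs1 : e * (w + h) < d1) by (eapply Rlt_le_trans; [exact Hs | apply Rmin_l]).
    assert (Hs2 : e * (w + h) < d2) by (eapply Rlt_le_trans; [exact Hs | apply Rmin_r]).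
    assert (Hwe : 0 < w * e) by nra. assert (Hhe : 0 < h * e) by nra.
    assert (Hnear : forall u v, a <= u <= a + w * e -> c <= v <= c + h * e ->
       Rabs (u - x) <= w * e /\ Rabs (v - y) <= h * e).
    { intros u v Hu Hv; split; apply Rabs_le; lra. }
    assert (HP2 : forall u v, a <= u <= a + w * e -> c <= v <= c + h * e ->
       Rabs (P u v - P x y - (p * (u - x) + k * (v - y))) <= e1 * (e * (w + h))).
    { intros u v Hu Hv; destruct (Hnear u v Hu Hv).
      eapply Rle_trans; [apply HP1; lra|].
      apply Rmult_le_compat_l; [lra|]. apply Rmax_lub; lra. }
    assert (HQ2 : forall u v, a <= u <= a + w * e -> c <= v <= c + h * e ->
       Rabs (Q u v - Q x y - (k * (u - x) + q * (v - y))) <= e1 * (e * (w + h))).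
    { intros u v Hu Hv; destruct (Hnear u v Hu Hv).
      eapply Rle_trans; [apply HQ1; lra|].
      apply Rmult_le_compat_l; [lra|]. apply Rmax_lub; lra. }
    assert (IP := RInt_difference_close (fun u => P u c) (fun u => P u (c + h * e))
      a (a + w * e) (- k * (h * e)) (2 * (e1 * (e * (w + h))))).
    assert (IQ := RInt_difference_close (fun v => Q (a + w * e) v) (fun v => Q a v)
      c (c + h * e) (k * (w * e)) (2 * (e1 * (e * (w + h))))).
    specialize (IP ltac:(lra)). specialize (IQ ltac:(lra)).
    lapply IP; [clear IP; intros IP | intros; apply HPx; lra].
    lapply IP; [clear IP; intros IP | intros; apply HPx; lra].
    lapply IQ; [clear IQ; intros IQ | intros; apply HQy; lra].
    lapply IQ; [clear IQ; intros IQ | intros; apply HQy; lra].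
    lapply IP; [clear IP; intros IP | ].
    2:{ intros u Hu.
        generalize (HP2 u c Hu ltac:(lra)) (HP2 u (c + h * e) Hu ltac:(lra)).
        intros G1 G2; apply Rabs_le_between in G1, G2; apply Rabs_le; lra. }
    lapply IQ; [clear IQ; intros IQ | ].
    2:{ intros v Hv.
        generalize (HQ2 a v ltac:(lra) Hv) (HQ2 (a + w * e) v ltac:(lra) Hv).
        intros G1 G2; apply Rabs_le_between in G1, G2; apply Rabs_le; lra. }
    unfold contour.
    apply Rle_trans with
      ((a + w * e - a) * (2 * (e1 * (e * (w + h)))) +
       (c + h * e - c) * (2 * (e1 * (e * (w + h))))).
    - apply Rabs_le_between in IP, IQ; apply Rabs_le; lra.
    - right; unfold e1; field; lra. }
  destruct (Rle_lt_dec (Rabs (contour P Q A B C D)) 0) as [Hz|Hz].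
  - generalize (Rabs_pos (contour P Q A B C D)); intros.
    apply NNPP; intros Hn; apply Rabs_pos_lt in Hn; lra.
  - exfalso. set (a := Rabs (contour P Q A B C D)) in *.
    assert (0 <= (B - A) * (D - C)) by nra.
    specialize (Heps (a / (2 * (1 + (B - A) * (D - C))))).
    lapply Heps; [clear Heps; intros Heps | apply Rdiv_lt_0_compat; lra].
    apply Rmult_le_compat_r with (r := 2 * (1 + (B - A) * (D - C))) in Heps; [|lra].
    replace (a / (2 * (1 + (B - A) * (D - C))) * ((B - A) * (D - C)) *
      (2 * (1 + (B - A) * (D - C)))) with (a * ((B - A) * (D - C))) in Heps by (field; lra).
    nra.
Qed.

Lemma max_on_rectangle (F : R -> R -> R) (A B C D : R) :
  A <= B -> C <= D ->
  (forall x y, A <= x <= B -> C <= y <= D -> continuity_2d_pt F x y) ->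
  exists x y, A <= x <= B /\ C <= y <= D /\
    forall u v, A <= u <= B -> C <= v <= D -> F u v <= F x y.
Proof.
  intros HAB HCD HF. apply NNPP; intros Hn.
  assert (Hup : forall x y, A <= x <= B -> C <= y <= D ->
    exists u v, A <= u <= B /\ C <= v <= D /\ F x y < F u v).
  { intros x y Hx Hy; apply NNPP; intros Hxy; apply Hn.
    exists x, y; repeat split; try tauto; try lra. intros u v Hu Hv.
    apply Rnot_lt_le; intros Hlt; apply Hxy; exists u, v; tauto. }
  destruct (quartering (fun a b c d => exists u v, A <= u <= B /\ C <= v <= D /\
     forall x y, a <= x <= b -> c <= y <= d -> F x y < F u v) A B C D)
    as (u & v & Hu & Hv & Huv); trivial.
  - intros a b c d _ _ _ _ _ _ (u1 & v1 & U1 & V1 & M1) (u2 & v2 & U2 & V2 & M2)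
      (u3 & v3 & U3 & V3 & M3) (u4 & v4 & U4 & V4 & M4).
    assert (Hbest : forall u v u' v', A <= u <= B -> C <= v <= D -> A <= u' <= B ->
        C <= v' <= D -> exists s t, A <= s <= B /\ C <= t <= D /\
        F u v <= F s t /\ F u' v' <= F s t).
    { intros u v u' v' ? ? ? ?; destruct (Rle_lt_dec (F u v) (F u' v')).
      - exists u', v'; repeat split; lra.
      - exists u, v; repeat split; lra. }
    destruct (Hbest u1 v1 u2 v2 U1 V1 U2 V2) as (u5 & v5 & U5 & V5 & L1 & L2).
    destruct (Hbest u3 v3 u4 v4 U3 V3 U4 V4) as (u6 & v6 & U6 & V6 & L3 & L4).
    destruct (Hbest u5 v5 u6 v6 U5 V5 U6 V6) as (u7 & v7 & U7 & V7 & L5 & L6).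
    exists u7, v7; split; [exact U7 | split; [exact V7|]].
    intros x y Hx Hy.
    destruct (Rle_lt_dec x ((a + b) / 2)), (Rle_lt_dec y ((c + d) / 2)).
    + generalize (M1 x y ltac:(lra) ltac:(lra)); lra.
    + generalize (M3 x y ltac:(lra) ltac:(lra)); lra.
    + generalize (M2 x y ltac:(lra) ltac:(lra)); lra.
    + generalize (M4 x y ltac:(lra) ltac:(lra)); lra.
  - intros x y Hx Hy.
    destruct (Hup x y Hx Hy) as (u & v & Hu & Hv & Hlt).
    assert (He : 0 < F u v - F x y) by lra.
    destruct (HF x y Hx Hy (mkposreal _ He)) as [[r Hr] Hc]; simpl in Hc.
    exists (r / (1 + (B - A) + (D - C))); split.
    { apply Rdiv_lt_0_compat; lra. }
    intros e a c [He0 He1] _ Hxa _ _ Hyc _.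
    exists u, v; split; [exact Hu | split; [exact Hv|]].
    assert (e * (1 + (B - A) + (D - C)) < r).
    { apply Rmult_lt_compat_r with (r := 1 + (B - A) + (D - C)) in He1; [|lra].
      unfold Rdiv in He1; rewrite Rmult_assoc, Rinv_l, Rmult_1_r in He1; lra. }
    intros s t Hs Ht.
    assert (G : Rabs (F s t - F x y) < F u v - F x y).
    { apply Hc; apply Rabs_def1; nra. }
    apply Rabs_def2 in G; lra.
  - generalize (Huv u v Hu Hv); lra.
Qed.

(** * Gradients and complex derivatives *)

Definition has_grad (v : C -> R) (z : C) (a b : R) : Prop :=
  differentiable_pt_lim (fun x y => v (x, y)) (fst z) (snd z) a b.

Lemma Rabs_fst_le (z : C) : Rabs (fst z) <= Cmod z.
Proof. eapply Rle_trans; [apply Rmax_l | apply Rmax_Cmod]. Qed.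

Lemma Rabs_snd_le (z : C) : Rabs (snd z) <= Cmod z.
Proof. eapply Rle_trans; [apply Rmax_r | apply Rmax_Cmod]. Qed.

Lemma Cmod_le_2Rmax (z : C) : Cmod z <= 2 * Rmax (Rabs (fst z)) (Rabs (snd z)).
Proof.
  eapply Rle_trans; [apply Cmod_2Rmax|].
  apply Rmult_le_compat_r.
  - eapply Rle_trans; [apply Rabs_pos | apply Rmax_l].
  - apply Rsqr_incr_0; try lra; [|apply sqrt_pos].
    rewrite Rsqr_sqrt by lra; unfold Rsqr; lra.
Qed.

Lemma locally_Cmod (z : C) (P : C -> Prop) :
  locally z P <-> exists r, 0 < r /\ forall w, Cmod (w - z) < r -> P w.
Proof.
  split.
  - intros H. apply locally_C in H. destruct H as [[r Hr] H].
    exists r; split; trivial. 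
  - intros (r & Hr & H). apply locally_C. exists (mkposreal r Hr). exact H.
Qed.

Lemma is_derive_C_eps (h : C -> C) (z d : C) :
  C_is_derive h z d <->
  forall eps, 0 < eps -> exists r, 0 < r /\ forall w, Cmod (w - z) < r ->
    Cmod (h w - h z - d * (w - z)) <= eps * Cmod (w - z).
Proof.
  split.
  - intros [_ H] eps Heps.
    specialize (H z (fun P HP => HP) (mkposreal eps Heps)).
    destruct H as [[r Hr] H].
    exists r; split; trivial. intros w Hw; specialize (H w Hw).
    change (Cmod (h w - h z - (w - z) * d) <= eps * Cmod (w - z)) in H.
    rewrite (Cmult_comm d). exact H.
  - intros H; split; [apply is_linear_scal_l|].
    intros x Hx.
    assert (E := is_filter_lim_locally_unique (V := AbsRing_NormedModule C_AbsRing) _ _ Hx).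
    simpl in E; subst x.
    intros [eps Heps]. destruct (H eps Heps) as (r & Hr & Hl).
    exists (mkposreal r Hr). intros w Hw.
    change (Cmod (h w - h z - (w - z) * d) <= eps * Cmod (w - z)).
    rewrite (Cmult_comm (w - z)). apply Hl, Hw.
Qed.

(** The Cauchy-Riemann equations. *)
Lemma is_derive_C_has_grad (h : C -> C) (z d : C) :
  C_is_derive h z d ->
  has_grad (fun w => fst (h w)) z (fst d) (- snd d) /\
  has_grad (fun w => snd (h w)) z (snd d) (fst d).
Proof.
  intros H. 
  assert (G : forall eps : posreal, exists delta : posreal, forall u v,
    Rabs (u - fst z) < delta -> Rabs (v - snd z) < delta ->
    Cmod (h (u, v) - h z - d * ((u, v) - z)) <=
    eps * Rmax (Rabs (u - fst z)) (Rabs (v - snd z))).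
  { intros [eps Heps].
    destruct (proj1 (is_derive_C_eps h z d) H (eps / 2)) as (r & Hr & Hl); [lra|].
    assert (Hr2 : 0 < r / 2) by lra.
    exists (mkposreal _ Hr2); simpl; intros u v Hu Hv.
    assert (E := Cmod_le_2Rmax ((u, v) - z)%C).
    change (fst ((u, v) - z)%C) with (u - fst z) in E.
    change (snd ((u, v) - z)%C) with (v - snd z) in E.
    eapply Rle_trans; [apply Hl|].
    - eapply Rle_lt_trans; [exact E|].
      apply Rlt_le_trans with (2 * (r / 2)); [|lra].
      apply Rmult_lt_compat_l; [lra|]. apply Rmax_lub_lt; trivial.
    - eapply Rle_trans; [apply Rmult_le_compat_l; [lra | exact E]|]. lra. }
  destruct z as [x y], d as [d1 d2].
  split; intros eps; destruct (G eps) as [delta Hd]; exists delta;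
    intros u v Hu Hv; (eapply Rle_trans; [|apply Hd; trivial]);
    simpl fst; simpl snd.
  - eapply Rle_trans; [|apply Rabs_fst_le]. right; f_equal. simpl. ring.
  - eapply Rle_trans; [|apply Rabs_snd_le]. right; f_equal. simpl. ring.
Qed.

Lemma has_grad_continuous (v : C -> R) (z : C) (a b : R) :
  has_grad v z a b -> continuity_2d_pt (fun x y => v (x, y)) (fst z) (snd z).
Proof. intros H; apply differentiable_continuity_pt; exists a, b; exact H. Qed.

Lemma has_grad_opp (v : C -> R) (z : C) (a b : R) :
  has_grad v z a b -> has_grad (fun w => - v w) z (- a) (- b).
Proof.
  intros H eps; destruct (H eps) as [delta Hd]; exists delta; intros x y Hx Hy.
  eapply Rle_trans; [|apply (Hd x y Hx Hy)].
  right; rewrite <- Rabs_Ropp; f_equal; ring.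
Qed.

(** * The mean value property *)

Definition circ (z : C) (r theta : R) : C :=
  (fst z + r * cos theta, snd z + r * sin theta).

Lemma Cmod_circ (z : C) (r theta : R) : Cmod (circ z r theta - z) = Rabs r.
Proof.
  unfold circ, Cmod; simpl. rewrite <- sqrt_Rsqr_abs; f_equal; unfold Rsqr.
  assert (E := sin2_cos2 theta); unfold Rsqr in E.
  replace (_ + _) with (r * r * (sin theta * sin theta + cos theta * cos theta)) by ring.
  rewrite E; ring.
Qed.

Lemma is_derive_eps (f : R -> R) (y l : R) :
  is_derive f y l -> forall eps, 0 < eps -> exists r, 0 < r /\
    forall v, Rabs (v - y) < r ->
      Rabs (f v - f y - l * (v - y)) <= eps * Rabs (v - y).
Proof.
  intros [_ H] eps Heps.
  specialize (H y (fun P HP => HP) (mkposreal eps Heps)).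
  destruct H as [[r Hr] H].
  exists r; split; trivial. intros w Hw; specialize (H w Hw).
  change (Rabs (f w - f y - (w - y) * l) <= eps * Rabs (w - y)) in H.
  rewrite (Rmult_comm l). exact H.
Qed.

Lemma differentiable_pt_lim_snd (f : R -> R) (x y l : R) :
  is_derive f y l -> differentiable_pt_lim (fun _ v => f v) x y 0 l.
Proof.
  intros H [eps Heps]. destruct (is_derive_eps f y l H eps Heps) as (r & Hr & Hl).
  exists (mkposreal r Hr); simpl; intros u v _ Hv.
  replace (0 * (u - x) + l * (v - y)) with (l * (v - y)) by ring.
  eapply Rle_trans; [apply Hl, Hv|]. apply Rmult_le_compat_l; [lra | apply Rmax_r].
Qed.

Lemma differentiable_pt_lim_bilinear (c x y : R) :
  differentiable_pt_lim (fun u v => c + u * v) x y y x.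
Proof.
  intros eps; exists eps; intros u v Hu Hv.
  replace (_ - _ - _) with ((u - x) * (v - y)) by ring.
  rewrite Rabs_mult. apply Rmult_le_compat; try apply Rabs_pos; [lra | apply Rmax_r].
Qed.

Lemma differentiable_pt_lim_circ (v : C -> R) (z : C) (r theta a b : R) :
  has_grad v (circ z r theta) a b ->
  differentiable_pt_lim (fun s t => v (circ z s t)) r theta
    (a * cos theta + b * sin theta) (r * (b * cos theta - a * sin theta)).
Proof.
  intros H.
  assert (H1 : forall c (f : R -> R) (l : R), is_derive f theta l ->
    differentiable_pt_lim (fun s t => c + s * f t) r theta (f theta) (r * l)).
  { intros c f l Hf.
    replace (f theta) with (f theta * 1 + r * 0) by ring.
    replace (r * l) with (f theta * 0 + r * l) by ring.
    apply (differentiable_pt_lim_comp (fun u v => c + u * v) (fun s _ => s)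
             (fun _ t => f t)).
    - apply differentiable_pt_lim_bilinear.
    - apply differentiable_pt_lim_proj1_0, derivable_pt_lim_id.
    - apply differentiable_pt_lim_snd, Hf. }
  replace (r * (b * cos theta - a * sin theta)) with
    (a * (r * - sin theta) + b * (r * cos theta)) by ring.
  apply (differentiable_pt_lim_comp (fun x y => v (x, y))
    (fun s t => fst z + s * cos t) (fun s t => snd z + s * sin t)).
  - exact H.
  - apply H1. apply is_derive_cos.
  - apply H1. apply is_derive_sin.
Qed.

Lemma PI2_pos : 0 < 2 * PI.
Proof. generalize PI_RGT_0; lra. Qed.

(** In polar coordinates the Cauchy-Riemann equations say that the form
    [(q / r) dr + p dtheta] is closed.  Its integrals along the rays of angle [0]
    and [2 PI] cancel, so the one along the circles does not depend on the
    radius. *)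
Lemma circle_integral_radius (p q : C -> R) (z0 : C) (r0 r1 : R) :
  0 < r0 <= r1 ->
  (forall z, r0 <= Cmod (z - z0) <= r1 ->
     exists a b, has_grad p z a (- b) /\ has_grad q z b a) ->
  RInt (fun t => p (circ z0 r1 t)) 0 (2 * PI) =
  RInt (fun t => p (circ z0 r0 t)) 0 (2 * PI).
Proof.
  intros Hr Hpq. generalize PI2_pos; intros Hpi.
  destruct (Req_dec r0 r1) as [->|Hne]; [reflexivity|].
  assert (E' : contour (fun s t => / s * q (circ z0 s t)) (fun s t => p (circ z0 s t))
    r0 r1 0 (2 * PI) = 0).
  { apply goursat; try lra. intros s t Hs Ht.
    destruct (Hpq (circ z0 s t)) as (a & b & Hp & Hq).
    { rewrite Cmod_circ, Rabs_pos_eq; lra. }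
    exists (- / s ^ 2 * q (circ z0 s t) + / s * (b * cos t + a * sin t)),
      (a * cos t - b * sin t), (s * (- b * cos t - a * sin t)).
    split.
    - replace (- / s ^ 2 * q (circ z0 s t) + / s * (b * cos t + a * sin t)) with
        (q (circ z0 s t) * (- / s ^ 2) + / s * (b * cos t + a * sin t)) by ring.
      replace (a * cos t - b * sin t) with
        (q (circ z0 s t) * 0 + / s * (s * (a * cos t - b * sin t))) by (field; lra).
      apply differentiable_pt_lim_ext with (fun x y => 0 + / x * q (circ z0 x y)).
      { exists (mkposreal 1 Rlt_0_1); intros; ring. }
      apply (differentiable_pt_lim_comp (fun u v => 0 + u * v) (fun s _ => / s)
        (fun s t => q (circ z0 s t))).
      + apply differentiable_pt_lim_bilinear.
      + apply (differentiable_pt_lim_proj1_0 Rinv).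
        apply is_derive_Reals. auto_derive; [lra|]. field; lra.
      + apply differentiable_pt_lim_circ, Hq.
    - replace (a * cos t - b * sin t) with (a * cos t + - b * sin t) by ring.
      apply differentiable_pt_lim_circ, Hp. }
  unfold contour in E'.
  replace (RInt (fun x => / x * q (circ z0 x (2 * PI))) r0 r1)
    with (RInt (fun x => / x * q (circ z0 x 0)) r0 r1) in E'; [lra|].
  apply RInt_ext. intros x _; unfold circ.
  rewrite cos_0, sin_0, cos_2PI, sin_2PI; reflexivity.
Qed.

Lemma continuous_circ (v : C -> R) (z : C) (r t : R) :
  continuity_2d_pt (fun x y => v (x, y)) (fst (circ z r t)) (snd (circ z r t)) ->
  continuous (fun t => v (circ z r t)) t.
Proof.
  intros H. apply continuity_2d_pt_filterlim in H.
  apply (continuous_comp_2 (fun t => fst z + r * cos t) (fun t => snd z + r * sin t)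
           (fun x y => v (x, y))).
  - apply (ex_derive_continuous (V := R_NormedModule)); auto_derive; trivial.
  - apply (ex_derive_continuous (V := R_NormedModule)); auto_derive; trivial.
  - exact H.
Qed.

(** Differentiability at the centre is replaced by continuity so that the lemma
    applies to difference quotients. *)
Lemma mean_value (p q : C -> R) (z0 : C) (rho r : R) :
  0 < r < rho ->
  (forall z, 0 < Cmod (z - z0) < rho ->
     exists a b, has_grad p z a (- b) /\ has_grad q z b a) ->
  (forall eps, 0 < eps -> exists delta, 0 < delta /\
     forall z, Cmod (z - z0) < delta -> Rabs (p z - p z0) <= eps) ->
  RInt (fun t => p (circ z0 r t)) 0 (2 * PI) = 2 * PI * p z0.
Proof.
  intros Hr Hpq Hc. generalize PI2_pos; intros Hpi.
  apply cond_eq. intros eps Heps.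
  destruct (Hc (eps / (4 * PI))) as (delta & Hd & Hclose).
  { apply Rdiv_lt_0_compat; lra. }
  set (r0 := Rmin r (delta / 2)).
  assert (Hr0 : 0 < r0) by (apply Rmin_glb_lt; lra).
  assert (r0 <= r) by apply Rmin_l.
  assert (r0 <= delta / 2) by apply Rmin_r.
  rewrite (circle_integral_radius p q z0 r0 r); [| lra | intros z Hz; apply Hpq; lra].
  assert (I := RInt_difference_close (fun t => p (circ z0 r0 t)) (fun _ => p z0)
     0 (2 * PI) 0 (eps / (4 * PI))).
  rewrite RInt_const in I. unfold scal in I; simpl in I; unfold mult in I; simpl in I.
  apply Rle_lt_trans with ((2 * PI - 0) * (eps / (4 * PI))).
  - replace (RInt (fun t => p (circ z0 r0 t)) 0 (2 * PI) - 2 * PI * p z0) with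
     (RInt (fun t => p (circ z0 r0 t)) 0 (2 * PI) - (2 * PI - 0) * p z0 - 0 * (2 * PI - 0))
     by ring.
    apply I; [lra | | |].
    + intros t _. destruct (Hpq (circ z0 r0 t)) as (a & b & Hp & _).
      { rewrite Cmod_circ, Rabs_pos_eq; lra. }
      apply continuous_circ. eapply has_grad_continuous; exact Hp.
    + intros t _; apply continuous_const.
    + intros t _. rewrite Rminus_0_r. apply Hclose.
      rewrite Cmod_circ, Rabs_pos_eq; lra.
  - replace ((2 * PI - 0) * (eps / (4 * PI))) with (eps / 2) by (field; lra). lra.
Qed.

(** * Continuity of complex derivatives *)

Lemma is_derive_Cinv (z : C) : z <> 0 ->
  C_is_derive Cinv z (- / (z * z))%C.
Proof.
  intros Hz; apply is_derive_C_eps; intros eps Heps.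
  assert (Hm : 0 < Cmod z) by (apply Cmod_gt_0; exact Hz).
  set (m := Cmod z) in *.
  exists (Rmin (m / 2) (eps * m ^ 3 / 2)); split.
  { apply Rmin_glb_lt; [lra|]. apply Rdiv_lt_0_compat; [|lra].
    apply Rmult_lt_0_compat; trivial; apply pow_lt, Hm. }
  intros w Hw.
  assert (H1 : Cmod (w - z) < m / 2) by (eapply Rlt_le_trans; [exact Hw | apply Rmin_l]).
  assert (H2 : Cmod (w - z) < eps * m ^ 3 / 2) by (eapply Rlt_le_trans; [exact Hw | apply Rmin_r]).
  assert (Hwm : m / 2 <= Cmod w).
  { assert (T := Cmod_triangle w (z - w)).
    replace (w + (z - w))%C with z in T by ring. fold m in T.
    replace (z - w)%C with (- (w - z))%C in T by ring. rewrite Cmod_opp in T. lra. }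
  assert (Hw0 : w <> 0) by (apply Cmod_gt_0; lra).
  replace (/ w - / z - - / (z * z) * (w - z))%C
    with ((w - z) * ((w - z) / (z * z * w)))%C by (field; split; assumption).
  rewrite Cmod_mult, Rmult_comm. apply Rmult_le_compat_r; [apply Cmod_ge_0|].
  rewrite Cmod_div, !Cmod_mult by (repeat apply Cmult_neq_0; assumption).
  fold m. assert (Hmm : 0 < m * m * Cmod w) by (repeat apply Rmult_lt_0_compat; lra).
  apply Rmult_le_reg_r with (m * m * Cmod w); trivial.
  unfold Rdiv; rewrite Rmult_assoc, Rinv_l, Rmult_1_r by lra.
  eapply Rle_trans; [left; exact H2|].
  replace (eps * m ^ 3 / 2) with (eps * (m * m * (m / 2))) by field.
  apply Rmult_le_compat_l; [lra|]. apply Rmult_le_compat_l; nra.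
Qed.

(** Over the complex numbers, the rules for products and compositions are
    stated for another normed module structure with the same norm. *)
Lemma is_derive_C_AbsRing (f : C -> C) (z d : C) :
  C_is_derive f z d <->
  is_derive (K := C_AbsRing) (V := AbsRing_NormedModule C_AbsRing) f z d.
Proof.
  split; intros [_ H]; (split; [apply is_linear_scal_l | exact H]).
Qed.

Lemma is_derive_Cdiv (f g : C -> C) (z df dg : C) :
  C_is_derive f z df ->
  C_is_derive g z dg ->
  g z <> 0 ->
  C_is_derive (fun w => (f w / g w)%C) z
    ((df * g z - f z * dg) / (g z * g z))%C.
Proof.
  intros Hf Hg H0.
  assert (Hi : C_is_derive (fun w => (/ g w)%C) z
     (dg * - / (g z * g z))%C).
  { apply (is_derive_comp (K := C_AbsRing) (V := C_NormedModule) Cinv g).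
    - apply is_derive_Cinv, H0.
    - apply is_derive_C_AbsRing, Hg. }
  assert (Hm := is_derive_mult (K := C_AbsRing) f (fun w => (/ g w)%C) z _ _
                 (proj1 (is_derive_C_AbsRing _ _ _) Hf)
                 (proj1 (is_derive_C_AbsRing _ _ _) Hi)
                 (fun n m => Cmult_comm n m)).
  match type of Hm with is_derive _ _ ?l => 
    replace ((df * g z - f z * dg) / (g z * g z))%C with l end.
  - apply is_derive_C_AbsRing, Hm.
  - change ((df * / g z + f z * (dg * - / (g z * g z)))%C =
       ((df * g z - f z * dg) / (g z * g z))%C).
    field; assumption.
Qed.

Lemma is_derive_C_minus_const (f : C -> C) (c z d : C) :
  C_is_derive f z d ->
  C_is_derive (fun w => (f w - c)%C) z d.
Proof.
  intros H. apply is_derive_C_eps; intros eps Heps.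
  destruct (proj1 (is_derive_C_eps f z d) H eps Heps) as (r & Hr & Hl).
  exists r; split; trivial. intros w Hw.
  replace (f w - c - (f z - c) - d * (w - z))%C with (f w - f z - d * (w - z))%C by ring.
  apply Hl, Hw.
Qed.

Lemma is_derive_C_id (z : C) :
  C_is_derive (fun w => w) z (RtoC 1).
Proof. apply is_derive_C_AbsRing, (is_derive_id (K := C_AbsRing)). Qed.

Lemma is_derive_C_const (k z : C) :
  C_is_derive (fun _ => k) z (RtoC 0).
Proof.
  exact (is_derive_const (K := C_AbsRing) (V := C_NormedModule) k z).
Qed.

Lemma circ_minus (z : C) (r t : R) : (circ z r t - z)%C = (r * cos t, r * sin t).
Proof.
  unfold circ; apply injective_projections; simpl; ring.
Qed.

(** Cauchy's formula for the derivative at the centre of a circle, in real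
    form: the mean value property of the difference quotient
    [(h w - h z) / (w - z)] extended by [d z] to [w = z]. *)
Lemma cauchy_derivative (h d : C -> C) (z : C) (r rho : R) :
  0 < r < rho ->
  (forall w, Cmod (w - z) < rho ->
     C_is_derive h w (d w)) ->
  RInt (fun t => ((fst (h (circ z r t)) - fst (h z)) * cos t
                 + (snd (h (circ z r t)) - snd (h z)) * sin t) / r) 0 (2 * PI)
    = 2 * PI * fst (d z) /\
  RInt (fun t => ((snd (h (circ z r t)) - snd (h z)) * cos t
                 - (fst (h (circ z r t)) - fst (h z)) * sin t) / r) 0 (2 * PI)
    = 2 * PI * snd (d z).
Proof.
  intros Hr Hd.
  set (k := fun w => if excluded_middle_informative (w = z) then d z
                     else ((h w - h z) / (w - z))%C).
  assert (Hkz : k z = d z).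
  { unfold k; destruct excluded_middle_informative; tauto. }
  assert (Hkw : forall w, w <> z -> k w = ((h w - h z) / (w - z))%C).
  { intros w Hw; unfold k; destruct excluded_middle_informative; tauto. }
  assert (Hsub : forall w, w <> z -> (w - z)%C <> 0).
  { intros w Hw E; apply Hw. replace w with (w - z + z)%C by ring. rewrite E; ring. }
  assert (Hkd : forall w, 0 < Cmod (w - z) < rho -> exists e : C,
     C_is_derive k w e).
  { intros w Hw. eexists.
    apply (is_derive_ext_loc (K := C_AbsRing) (V := C_NormedModule)
      (fun w => ((h w - h z) / (w - z))%C)).
    - apply locally_C, locally_Cmod. exists (Cmod (w - z)); split; [lra|].
      intros y Hy; symmetry; apply Hkw. intros ->.
      replace (z - w)%C with (- (w - z))%C in Hy by ring. rewrite Cmod_opp in Hy; lra.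
    - apply (is_derive_Cdiv (fun w => h w - h z)%C (fun w => w - z)%C).
      + apply is_derive_C_minus_const, Hd; lra.
      + apply is_derive_C_minus_const, is_derive_C_id.
      + apply Cmod_gt_0; lra. }
  assert (Hkc : forall eps, 0 < eps -> exists delta, 0 < delta /\
     forall w, Cmod (w - z) < delta -> Cmod (k w - k z) <= eps).
  { intros eps Heps.
    destruct (proj1 (is_derive_C_eps h z (d z)) (Hd z ltac:(unfold Cminus; rewrite Cplus_opp_r, Cmod_0; lra))
       eps Heps) as (delta & Hdel & Hl).
    exists delta; split; trivial. intros w Hw.
    destruct (excluded_middle_informative (w = z)) as [->|Hne].
    { unfold Cminus; rewrite Cplus_opp_r, Cmod_0; lra. }
    rewrite Hkz, Hkw by trivial.
    replace ((h w - h z) / (w - z) - d z)%C with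
      ((h w - h z - d z * (w - z)) / (w - z))%C by (field; apply Hsub, Hne).
    assert (0 < Cmod (w - z)) by (apply Cmod_gt_0, Hsub, Hne).
    rewrite Cmod_div by (apply Hsub, Hne).
    apply Rmult_le_reg_r with (Cmod (w - z)); trivial.
    unfold Rdiv; rewrite Rmult_assoc, Rinv_l, Rmult_1_r by lra.
    apply Hl, Hw. }
  assert (Hcirc : forall t, k (circ z r t) = 
     (((fst (h (circ z r t)) - fst (h z)) * cos t
                 + (snd (h (circ z r t)) - snd (h z)) * sin t) / r,
      ((snd (h (circ z r t)) - snd (h z)) * cos t
                 - (fst (h (circ z r t)) - fst (h z)) * sin t) / r)).
  { intros t.
    assert (E := sin2_cos2 t); unfold Rsqr in E.
    assert (Hne : (circ z r t - z)%C <> 0).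
    { apply Cmod_gt_0; rewrite Cmod_circ, Rabs_pos_eq; lra. }
    rewrite Hkw by (intros E'; apply Hne; rewrite E'; ring).
    rewrite circ_minus.
    destruct (h (circ z r t)) as [a b], (h z) as [a' b'].
    unfold Cdiv, Cinv, Cmult, Cminus, Cplus, Copp; simpl.
    replace (r * cos t * (r * cos t * 1) + r * sin t * (r * sin t * 1))
      with (r * r) by (replace (r * r) with (r * r * (sin t * sin t + cos t * cos t))
        by (rewrite E; ring); ring).
    apply injective_projections; simpl; field; lra. }
  assert (Hc1 : forall eps, 0 < eps -> exists delta, 0 < delta /\
     forall w, Cmod (w - z) < delta -> Rabs (fst (k w) - fst (k z)) <= eps).
  { intros eps Heps; destruct (Hkc eps Heps) as (delta & Hdel & Hl).
    exists delta; split; trivial; intros w Hw.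
    eapply Rle_trans; [apply (Rabs_fst_le (k w - k z)%C) | apply Hl, Hw]. }
  assert (Hc2 : forall eps, 0 < eps -> exists delta, 0 < delta /\
     forall w, Cmod (w - z) < delta -> Rabs (snd (k w) - snd (k z)) <= eps).
  { intros eps Heps; destruct (Hkc eps Heps) as (delta & Hdel & Hl).
    exists delta; split; trivial; intros w Hw.
    eapply Rle_trans; [apply (Rabs_snd_le (k w - k z)%C) | apply Hl, Hw]. }
  split.
  - rewrite <- Hkz, <- (mean_value (fun w => fst (k w)) (fun w => snd (k w)) z rho r);
      trivial.
    + apply RInt_ext; intros t _; rewrite Hcirc; reflexivity.
    + intros w Hw. destruct (Hkd w Hw) as [e He].
      exists (fst e), (snd e). apply is_derive_C_has_grad, He.
  (* The imaginary part of [k] is the real part of [- i k]. *)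
  - rewrite <- Hkz, <- (mean_value (fun w => snd (k w)) (fun w => - fst (k w)) z rho r);
      trivial.
    + apply RInt_ext; intros t _; rewrite Hcirc; reflexivity.
    + intros w Hw. destruct (Hkd w Hw) as [e He].
      destruct (is_derive_C_has_grad k w e He) as [G1 G2].
      exists (snd e), (- fst e). rewrite Ropp_involutive; split; trivial.
      apply has_grad_opp in G1. rewrite Ropp_involutive in G1. exact G1.
Qed.

Lemma continuous_pair_comp (v : C -> R) (f g : R * R -> R) (u : R * R) :
  continuity_2d_pt (fun x y => v (x, y)) (f u) (g u) ->
  continuous f u -> continuous g u -> continuous (fun u => v (f u, g u)) u.
Proof.
  intros Hv Hf Hg. apply continuity_2d_pt_filterlim in Hv.
  apply (continuous_comp_2 f g (fun x y => v (x, y))); trivial.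
Qed.

Lemma integral_close (f g : R -> R) (m1 m2 eps : R) :
  (forall t, 0 <= t <= 2 * PI -> continuous f t) ->
  (forall t, 0 <= t <= 2 * PI -> continuous g t) ->
  RInt f 0 (2 * PI) = 2 * PI * m1 -> RInt g 0 (2 * PI) = 2 * PI * m2 ->
  (forall t, 0 <= t <= 2 * PI -> Rabs (f t - g t) <= eps) ->
  Rabs (m1 - m2) <= eps.
Proof.
  intros Hf Hg E1 E2 He. generalize PI2_pos; intros Hp.
  assert (I := RInt_difference_close f g 0 (2 * PI) 0 eps ltac:(lra) Hf Hg).
  rewrite E1, E2 in I.
  apply Rmult_le_reg_l with (2 * PI); trivial.
  rewrite <- (Rabs_pos_eq (2 * PI)) at 1 by lra. rewrite <- Rabs_mult.
  replace (2 * PI * (m1 - m2)) with (2 * PI * m1 - 2 * PI * m2 - 0 * (2 * PI - 0)) by ring.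
  replace (2 * PI * eps) with ((2 * PI - 0) * eps) by ring.
  apply I. intros t Ht; rewrite Rminus_0_r; apply He, Ht.
Qed.

(** In [cauchy_derivative] the radius can be kept fixed while the centre
    moves, and the integrand depends continuously on the centre.  Moving the
    centre along the real direction suffices to compute the derivative at a point
    from its values at nearby points. *)
Lemma derivative_continuous (h d : C -> C) (z0 : C) (rho : R) :
  0 < rho ->
  (forall z, Cmod (z - z0) < rho ->
     C_is_derive h z (d z)) ->
  forall eps, 0 < eps -> exists delta, 0 < delta /\
    forall s : R, Rabs s < delta -> Cmod (d (z0 + RtoC s)%C - d z0) <= eps.
Proof.
  intros Hrho Hd eps Heps.
  set (r := rho / 2). 
  set (p := fun w => fst (h w)). set (q := fun w => snd (h w)).
  set (F := fun s t => ((p (circ (z0 + RtoC s)%C r t) - p (z0 + RtoC s)%C) * cos t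
                 + (q (circ (z0 + RtoC s)%C r t) - q (z0 + RtoC s)%C) * sin t) / r).
  set (G := fun s t => ((q (circ (z0 + RtoC s)%C r t) - q (z0 + RtoC s)%C) * cos t
                 - (p (circ (z0 + RtoC s)%C r t) - p (z0 + RtoC s)%C) * sin t) / r).
  assert (Hpq : forall z, Cmod (z - z0) < rho ->
    continuity_2d_pt (fun x y => p (x, y)) (fst z) (snd z) /\
    continuity_2d_pt (fun x y => q (x, y)) (fst z) (snd z)).
  { intros z Hz; destruct (is_derive_C_has_grad h z (d z) (Hd z Hz)) as [H1 H2].
    split; eapply has_grad_continuous; [exact H1 | exact H2]. }
  assert (Hc : forall s t, Rabs s < r ->
     continuous (fun u : R * R => p (circ (z0 + RtoC (fst u))%C r (snd u))) (s, t) /\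
     continuous (fun u : R * R => p (z0 + RtoC (fst u))%C) (s, t) /\
     continuous (fun u : R * R => q (circ (z0 + RtoC (fst u))%C r (snd u))) (s, t) /\
     continuous (fun u : R * R => q (z0 + RtoC (fst u))%C) (s, t)).
  { intros s t Hs.
    assert (N1 : Cmod (circ (z0 + RtoC s) r t - z0)%C < rho).
    { replace (circ (z0 + RtoC s) r t - z0)%C with
        ((circ (z0 + RtoC s) r t - (z0 + RtoC s)) + RtoC s)%C by ring.
      eapply Rle_lt_trans; [apply Cmod_triangle|]. rewrite Cmod_circ, Cmod_R.
      rewrite (Rabs_pos_eq r); unfold r in *; lra. }
    assert (N2 : Cmod (z0 + RtoC s - z0)%C < rho).
    { replace (z0 + RtoC s - z0)%C with (RtoC s) by ring. rewrite Cmod_R.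
      unfold r in Hs; lra. }
    assert (C1 : continuous (fun u : R * R => fst z0 + fst u + r * cos (snd u)) (s, t)).
    { apply (continuous_plus (V := R_NormedModule)).
      - apply (continuous_plus (V := R_NormedModule)); [apply continuous_const | apply continuous_fst].
      - apply (continuous_scal_r (K:=R_AbsRing) (V := R_NormedModule) r (fun u : R * R => cos (snd u))).
        apply (continuous_comp (fun u : R*R => snd u) cos);
         [apply continuous_snd | apply continuous_cos]. }
    assert (C2 : continuous (fun u : R * R => snd z0 + 0 + r * sin (snd u)) (s, t)).
    { apply (continuous_plus (V := R_NormedModule)).
      - apply continuous_const.
      - apply (continuous_scal_r (K:=R_AbsRing) (V := R_NormedModule) r (fun u : R * R => sin (snd u))).
        apply (continuous_comp (fun u : R*R => snd u) sin);
         [apply continuous_snd | apply continuous_sin]. }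
    assert (C3 : continuous (fun u : R * R => fst z0 + fst u) (s, t)).
    { apply (continuous_plus (V := R_NormedModule)); [apply continuous_const | apply continuous_fst]. }
    assert (C4 : continuous (fun u : R * R => snd z0 + 0) (s, t)) by apply continuous_const.
    destruct (Hpq _ N1) as [P1 Q1]. destruct (Hpq _ N2) as [P2 Q2].
    repeat split.
    - exact (continuous_pair_comp p _ _ (s, t) P1 C1 C2).
    - exact (continuous_pair_comp p _ _ (s, t) P2 C3 C4).
    - exact (continuous_pair_comp q _ _ (s, t) Q1 C1 C2).
    - exact (continuous_pair_comp q _ _ (s, t) Q2 C3 C4). }
  assert (Hsc : forall s t : R, continuous (fun u : R * R => cos (snd u)) (s, t) /\
                            continuous (fun u : R * R => sin (snd u)) (s, t)).
  { intros s t; split; [apply (continuous_comp (fun u : R*R => snd u) cos)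
      | apply (continuous_comp (fun u : R*R => snd u) sin)];
     first [apply continuous_snd | apply continuous_cos | apply continuous_sin]. }
  assert (HFG : forall s t, Rabs s < r -> continuity_2d_pt F s t /\ continuity_2d_pt G s t).
  { intros s t Hs. destruct (Hc s t Hs) as (A1 & A2 & A3 & A4).
    destruct (Hsc s t) as (B1 & B2).
    split; apply continuity_2d_pt_filterlim.
    - unfold F. apply (continuous_mult (K := R_AbsRing)); [|apply continuous_const].
      apply (continuous_plus (V := R_NormedModule)); apply (continuous_mult (K := R_AbsRing)); trivial;
      apply (continuous_minus (V := R_NormedModule)); trivial.
    - unfold G. apply (continuous_mult (K := R_AbsRing)); [|apply continuous_const].
      apply (continuous_minus (V := R_NormedModule)); apply (continuous_mult (K := R_AbsRing)); trivial;
      apply (continuous_minus (V := R_NormedModule)); trivial. }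
  assert (Hr : 0 < r) by (unfold r; lra).
  assert (Hslice : forall H : R -> R -> R, (forall s t, Rabs s < r -> continuity_2d_pt H s t) ->
     forall s t, Rabs s < r -> continuous (fun t => H s t) t).
  { intros H HH s t Hs. specialize (HH s t Hs). apply continuity_2d_pt_filterlim in HH.
    apply (continuous_comp_2 (fun _ => s) (fun t => t) H); trivial;
      [apply continuous_const | apply continuous_id]. }
  assert (Heps2 : 0 < eps / 2) by lra.
  destruct (uniform_continuity_2d_1d' F 0 (2 * PI) 0) with (eps := mkposreal _ Heps2)
    as [[d1 Hd1] U1].
  { intros t _; apply HFG; rewrite Rabs_R0; exact Hr. }
  destruct (uniform_continuity_2d_1d' G 0 (2 * PI) 0) with (eps := mkposreal _ Heps2)
    as [[d2 Hd2] U2].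
  { intros t _; apply HFG; rewrite Rabs_R0; exact Hr. }
  simpl in U1, U2.
  exists (Rmin r (Rmin d1 d2)); split; [repeat apply Rmin_glb_lt; trivial|].
  intros s Hs.
  assert (S0 : Rabs s < r) by (eapply Rlt_le_trans; [exact Hs | apply Rmin_l]).
  assert (S1 : Rabs s < d1).
  { eapply Rlt_le_trans; [exact Hs | eapply Rle_trans; [apply Rmin_r | apply Rmin_l]]. }
  assert (S2 : Rabs s < d2).
  { eapply Rlt_le_trans; [exact Hs | eapply Rle_trans; [apply Rmin_r | apply Rmin_r]]. }
  assert (Z0 : (z0 + RtoC 0)%C = z0) by ring.
  assert (R0 : Rabs 0 < r) by (rewrite Rabs_R0; exact Hr).
  assert (Hcauchy : forall s, Rabs s < r ->
     RInt (F s) 0 (2 * PI) = 2 * PI * fst (d (z0 + RtoC s)%C) /\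
     RInt (G s) 0 (2 * PI) = 2 * PI * snd (d (z0 + RtoC s)%C)).
  { intros s' Hs'. apply (cauchy_derivative h d (z0 + RtoC s')%C r (rho - Rabs s')).
    - unfold r in *; lra.
    - intros w Hw; apply Hd.
      replace (w - z0)%C with ((w - (z0 + RtoC s')) + RtoC s')%C by ring.
      eapply Rle_lt_trans; [apply Cmod_triangle|]. rewrite Cmod_R; lra. }
  destruct (Hcauchy s S0) as [E1 E2]. destruct (Hcauchy 0 R0) as [E3 E4].
  rewrite Z0 in E3, E4.
  apply Rabs_def2 in S1, S2.
  eapply Rle_trans; [apply Cmod_le_2Rmax|].
  apply Rle_trans with (2 * (eps / 2)); [|lra].
  apply Rmult_le_compat_l; [lra|]. apply Rmax_lub.
  - apply (integral_close (F s) (F 0)); trivial.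
    + intros t _; apply Hslice; trivial; apply HFG.
    + intros t _; apply Hslice; trivial; apply HFG.
    + intros t Ht. left; apply U1; trivial; try lra. rewrite Rminus_diag, Rabs_R0; exact Hd1.
  - apply (integral_close (G s) (G 0)); trivial.
    + intros t _; apply Hslice; trivial; apply HFG.
    + intros t _; apply Hslice; trivial; apply HFG.
    + intros t Ht. left; apply U2; trivial; try lra. rewrite Rminus_diag, Rabs_R0; exact Hd2.
Qed.

(** * Laplacians by circle means *)

Definition mean_dev (v : C -> R) (z : C) (r : R) : R :=
  RInt (fun t => v (circ z r t) - v z) 0 (2 * PI).

Definition little_o2 (E : R -> R) : Prop :=
  forall eps, 0 < eps -> exists delta, 0 < delta /\
    forall r, 0 < r < delta -> Rabs (E r) <= eps * r ^ 2.

Definition continuous_near (v : C -> R) (z : C) : Prop :=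
  exists rho, 0 < rho /\ forall w, Cmod (w - z) < rho ->
    continuity_2d_pt (fun x y => v (x, y)) (fst w) (snd w).

(** For a function [v] with two continuous derivatives, the third field holds
    with [L] the Laplacian of [v] at [z].  The mean value property provides it
    for the real and imaginary parts of a complex differentiable function with
    [L = 0], although their second derivatives are not known to exist. *)
Record jet (v : C -> R) (z : C) (a b L : R) : Prop := {
  jet_cont : continuous_near v z;
  jet_grad : has_grad v z a b;
  jet_lap : little_o2 (fun r => mean_dev v z r - PI / 2 * L * r ^ 2)
}.

Lemma little_o2_plus (E F : R -> R) :
  little_o2 E -> little_o2 F -> little_o2 (fun r => E r + F r).
Proof.
  intros HE HF eps Heps.
  destruct (HE (eps / 2)) as (d1 & D1 & H1); [lra|].
  destruct (HF (eps / 2)) as (d2 & D2 & H2); [lra|].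
  exists (Rmin d1 d2); split; [apply Rmin_glb_lt; trivial|].
  intros r [Hr Hr'].
  assert (r < d1) by (eapply Rlt_le_trans; [exact Hr' | apply Rmin_l]).
  assert (r < d2) by (eapply Rlt_le_trans; [exact Hr' | apply Rmin_r]).
  eapply Rle_trans; [apply Rabs_triang|].
  generalize (H1 r) (H2 r); lra.
Qed.

Lemma little_o2_scal (k : R) (E : R -> R) :
  little_o2 E -> little_o2 (fun r => k * E r).
Proof.
  intros HE eps Heps. generalize (Rabs_pos k); intros Hk.
  destruct (HE (eps / (1 + Rabs k))) as (d & D & H).
  { apply Rdiv_lt_0_compat; lra. }
  exists d; split; trivial. intros r Hr. rewrite Rabs_mult.
  apply Rle_trans with (Rabs k * (eps / (1 + Rabs k) * r ^ 2)).
  - apply Rmult_le_compat_l; auto.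
  - assert (0 <= r ^ 2) by apply pow2_ge_0.
    replace (Rabs k * (eps / (1 + Rabs k) * r ^ 2)) with
      (eps * r ^ 2 * (Rabs k / (1 + Rabs k))) by (field; lra).
    rewrite <- (Rmult_1_r (eps * r ^ 2)) at 2.
    apply Rmult_le_compat_l; [apply Rmult_le_pos; lra|].
    apply Rmult_le_reg_r with (1 + Rabs k); [lra|].
    unfold Rdiv; rewrite Rmult_assoc, Rinv_l; lra.
Qed.

Lemma little_o2_ext (E F : R -> R) (d0 : R) :
  0 < d0 -> (forall r, 0 < r < d0 -> E r = F r) -> little_o2 E -> little_o2 F.
Proof.
  intros D0 HEF HE eps Heps. destruct (HE eps Heps) as (d & D & H).
  exists (Rmin d0 d); split; [apply Rmin_glb_lt; trivial|].
  intros r [Hr Hr'].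
  assert (r < d0) by (eapply Rlt_le_trans; [exact Hr' | apply Rmin_l]).
  assert (r < d) by (eapply Rlt_le_trans; [exact Hr' | apply Rmin_r]).
  rewrite <- HEF by lra. apply H; lra.
Qed.

Lemma little_o2_RInt (G : R -> R -> R) (d0 : R) :
  0 < d0 ->
  (forall r, 0 < r < d0 -> forall t, continuous (G r) t) ->
  (forall eps, 0 < eps -> exists delta, 0 < delta /\
     forall r t, 0 < r < delta -> Rabs (G r t) <= eps * r ^ 2) ->
  little_o2 (fun r => RInt (G r) 0 (2 * PI)).
Proof.
  intros D0 Hc HG eps Heps. generalize PI2_pos; intros Hp.
  destruct (HG (eps / (2 * PI))) as (d & D & H); [apply Rdiv_lt_0_compat; lra|].
  exists (Rmin d0 d); split; [apply Rmin_glb_lt; trivial|].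
  intros r [Hr Hr'].
  assert (r < d0) by (eapply Rlt_le_trans; [exact Hr' | apply Rmin_l]).
  assert (r < d) by (eapply Rlt_le_trans; [exact Hr' | apply Rmin_r]).
  apply Rle_trans with ((2 * PI - 0) * (eps / (2 * PI) * r ^ 2)).
  - apply abs_RInt_le_const; [lra | |].
    + apply ex_RInt_continuous_le; [lra|]. intros t _; apply Hc; lra.
    + intros t _; apply H; lra.
  - right; field; lra.
Qed.

Lemma circle_continuous (v : C -> R) (z : C) :
  continuous_near v z -> exists rho, 0 < rho /\
    forall r t, 0 < r < rho -> continuous (fun t => v (circ z r t)) t.
Proof.
  intros (rho & Hrho & H). exists rho; split; trivial. intros r t Hr.
  apply continuous_circ, H. rewrite Cmod_circ, Rabs_pos_eq; lra.
Qed.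

Lemma has_grad_circle (v : C -> R) (z : C) (a b : R) :
  has_grad v z a b ->
  forall eps, 0 < eps -> exists delta, 0 < delta /\
    forall r t, 0 < r < delta ->
      Rabs (v (circ z r t) - v z - r * (a * cos t + b * sin t)) <= eps * r.
Proof.
  intros H eps Heps. destruct (H (mkposreal eps Heps)) as [[d Hd] Hl].
  simpl in Hl. exists d; split; trivial. intros r t Hr.
  assert (Hc : Rabs (r * cos t) <= r).
  { rewrite Rabs_mult, Rabs_pos_eq by lra. rewrite <- (Rmult_1_r r) at 2.
    apply Rmult_le_compat_l; [lra|]. apply Rabs_le, COS_bound. }
  assert (Hs : Rabs (r * sin t) <= r).
  { rewrite Rabs_mult, Rabs_pos_eq by lra. rewrite <- (Rmult_1_r r) at 2.
    apply Rmult_le_compat_l; [lra|]. apply Rabs_le, SIN_bound. }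
  specialize (Hl (fst z + r * cos t) (snd z + r * sin t)).
  replace (fst z + r * cos t - fst z) with (r * cos t) in Hl by ring.
  replace (snd z + r * sin t - snd z) with (r * sin t) in Hl by ring.
  replace (r * (a * cos t + b * sin t)) with (a * (r * cos t) + b * (r * sin t)) by ring.
  rewrite (surjective_pairing z) at 2.
  eapply Rle_trans; [apply Hl; lra|].
  apply Rmult_le_compat_l; [lra|]. apply Rmax_lub; trivial.
Qed.

Lemma linear_form_bound (a b t : R) : Rabs (a * cos t + b * sin t) <= Rabs a + Rabs b.
Proof.
  eapply Rle_trans; [apply Rabs_triang|]. rewrite !Rabs_mult.
  assert (Rabs (cos t) <= 1) by (apply Rabs_le, COS_bound).
  assert (Rabs (sin t) <= 1) by (apply Rabs_le, SIN_bound).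
  generalize (Rabs_pos a) (Rabs_pos b); intros; nra.
Qed.

Lemma linear_form_square (a b : R) :
  is_RInt (fun t => (a * cos t + b * sin t) ^ 2) 0 (2 * PI) (PI * (a ^ 2 + b ^ 2)).
Proof.
  set (F := fun t => (a ^ 2 + b ^ 2) / 2 * t + (a ^ 2 - b ^ 2) / 2 * (sin t * cos t)
                     + a * b * sin t ^ 2).
  replace (PI * (a ^ 2 + b ^ 2)) with (minus (F (2 * PI)) (F 0)).
  - apply (is_RInt_derive (V := R_CompleteNormedModule) F).
    + intros t _. unfold F. auto_derive; trivial.
      assert (E := sin2_cos2 t); unfold Rsqr in E.
      replace (sin t ^ 1) with (sin t) by ring.
      replace (a ^ 2 * / 2) with (a ^ 2 * (/ 2 * 1)) by ring. 
      assert (E2 : cos t * cos t = 1 - sin t * sin t) by lra.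
      replace ((a * cos t + b * sin t) ^ 2) with
        (a ^ 2 * (cos t * cos t) + 2 * a * b * sin t * cos t + b ^ 2 * (sin t * sin t)) by ring.
      simpl. rewrite E2. ring_simplify. replace (cos t ^ 2) with (1 - sin t ^ 2) by (simpl; lra). field.
    + intros t _. apply (ex_derive_continuous (V := R_NormedModule)); auto_derive; trivial.
  - unfold F, minus, plus, opp; simpl. rewrite sin_2PI, cos_2PI, sin_0. field.
Qed.

Lemma taylor_second_order (phi phi1 : R -> R) (x l2 : R) :
  (exists eta, 0 < eta /\ forall s, Rabs (s - x) < eta -> is_derive phi s (phi1 s)) ->
  is_derive phi1 x l2 ->
  forall eps, 0 < eps -> exists eta, 0 < eta /\ forall s, Rabs (s - x) < eta ->
    Rabs (phi s - phi x - phi1 x * (s - x) - l2 / 2 * (s - x) ^ 2) <= eps * (s - x) ^ 2.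
Proof.
  intros (eta & Heta & Hphi) H2 eps Heps.
  destruct (is_derive_eps phi1 x l2 H2 eps Heps) as (eta2 & Heta2 & Hl).
  exists (Rmin eta eta2); split; [apply Rmin_glb_lt; trivial|].
  intros s Hs.
  assert (S1 : Rabs (s - x) < eta) by (eapply Rlt_le_trans; [exact Hs | apply Rmin_l]).
  assert (S2 : Rabs (s - x) < eta2) by (eapply Rlt_le_trans; [exact Hs | apply Rmin_r]).
  set (psi := fun s => phi s - phi1 x * (s - x) - l2 / 2 * (s - x) ^ 2).
  destruct (MVT_cor4 psi (fun s => phi1 s - phi1 x - l2 * (s - x)) x (Rabs (s - x)))
    with (b := s) as (c & Ec & Hc).
  - intros c Hc. unfold psi. 
    apply (is_derive_minus (V := R_NormedModule) (fun s => phi s - phi1 x * (s - x))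
             (fun s => l2 / 2 * (s - x) ^ 2)).
    + apply (is_derive_minus (V := R_NormedModule) phi).
      * apply Hphi; lra.
      * auto_derive; trivial; ring.
    + auto_derive; trivial. field.
  - lra.
  - replace (phi s - phi x - phi1 x * (s - x) - l2 / 2 * (s - x) ^ 2) with (psi s - psi x)
      by (unfold psi; ring).
    rewrite Ec, Rabs_mult.
    apply Rle_trans with (eps * Rabs (c - x) * Rabs (s - x)).
    + apply Rmult_le_compat_r; [apply Rabs_pos|]. apply Hl; lra.
    + rewrite <- (pow2_abs (s - x)).
      generalize (Rabs_pos (s - x)); intros.
      replace (eps * Rabs (s - x) ^ 2) with (eps * Rabs (s - x) * Rabs (s - x)) by ring.
      apply Rmult_le_compat_r; trivial. apply Rmult_le_compat_l; lra.
Qed.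

Lemma continuity_2d_pt_Cmod (v : C -> R) (z : C) (eps : R) :
  continuity_2d_pt (fun x y => v (x, y)) (fst z) (snd z) -> 0 < eps ->
  exists rho, 0 < rho /\ forall w, Cmod (w - z) < rho -> Rabs (v w - v z) < eps.
Proof.
  intros Hc Heps. destruct (Hc (mkposreal eps Heps)) as [[d Hd] H]; simpl in H.
  exists d; split; trivial. intros w Hw.
  rewrite (surjective_pairing w), (surjective_pairing z).
  apply H; (eapply Rle_lt_trans; [|exact Hw]).
  - apply (Rabs_fst_le (w - z)%C).
  - apply (Rabs_snd_le (w - z)%C).
Qed.

Lemma continuity_2d_pt_comp1 (phi : R -> R) (v : R -> R -> R) (x y : R) :
  continuous phi (v x y) -> continuity_2d_pt v x y ->
  continuity_2d_pt (fun x y => phi (v x y)) x y.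
Proof.
  intros Hp Hv. apply continuity_2d_pt_filterlim in Hv.
  apply continuity_2d_pt_filterlim.
  apply (continuous_comp (fun u : R * R => v (fst u) (snd u)) phi (x, y)); trivial.
Qed.

(** The chain rule for the Laplacian,
    [Delta (phi o v) = phi' Delta v + phi'' |grad v|^2].  In the second order
    expansion of [phi], only first order information on [v] enters the quadratic
    term, and the mean of the square of the linear form [a cos + b sin] is
    [(a^2 + b^2) / 2]. *)
Lemma jet_comp (phi phi1 : R -> R) (v : C -> R) (z : C) (a b L l1 l2 : R) :
  jet v z a b L ->
  (exists eta, 0 < eta /\ forall s, Rabs (s - v z) < eta -> is_derive phi s (phi1 s)) ->
  is_derive phi1 (v z) l2 -> phi1 (v z) = l1 ->
  jet (fun w => phi (v w)) z (l1 * a) (l1 * b) (l1 * L + l2 * (a ^ 2 + b ^ 2)).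
Proof.
  intros [Hc Hg Hl] Hphi Hphi1 <-.
  assert (Hc' : continuous_near (fun w => phi (v w)) z).
  { destruct Hc as (rho & Hrho & Hc). destruct Hphi as (eta & Heta & Hphi).
    destruct (continuity_2d_pt_Cmod v z eta) as (rho' & Hrho' & Hv); trivial.
    { eapply has_grad_continuous; exact Hg. }
    exists (Rmin rho rho'); split; [apply Rmin_glb_lt; trivial|].
    intros w Hw.
    apply (continuity_2d_pt_comp1 phi (fun x y => v (x, y))).
    - rewrite <- surjective_pairing.
      apply (ex_derive_continuous (V := R_NormedModule)). eexists; apply Hphi, Hv.
      eapply Rlt_le_trans; [exact Hw | apply Rmin_r].
    - apply Hc. eapply Rlt_le_trans; [exact Hw | apply Rmin_l]. }
  split; trivial.
  - replace (phi1 (v z) * a) with (phi1 (v z) * a + 0 * 0) by ring.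
    replace (phi1 (v z) * b) with (phi1 (v z) * b + 0 * 0) by ring.
    apply (differentiable_pt_lim_comp (fun s _ => phi s) (fun x y => v (x, y)) (fun _ _ => 0)).
    + apply differentiable_pt_lim_proj1_0, is_derive_Reals.
      rewrite <- surjective_pairing. destruct Hphi as (eta & Heta & Hphi).
      apply Hphi. rewrite Rminus_diag, Rabs_R0; exact Heta.
    + exact Hg.
    + apply differentiable_pt_lim_proj1_0 with (f := fun _ => 0), derivable_pt_lim_const.
  - destruct (circle_continuous v z Hc) as (r1 & Hr1 & Cv).
    destruct (circle_continuous _ z Hc') as (r2 & Hr2 & Cphi).
    set (l := fun t => a * cos t + b * sin t).
    set (G := fun r t => phi (v (circ z r t)) - phi (v z)
       - phi1 (v z) * (v (circ z r t) - v z) - l2 / 2 * (r ^ 2 * l t ^ 2)).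
    assert (HG : little_o2 (fun r => RInt (G r) 0 (2 * PI))).
    { apply little_o2_RInt with (Rmin r1 r2).
      - apply Rmin_glb_lt; trivial.
      - intros r [Hr Hr'] t.
        assert (r < r1) by (eapply Rlt_le_trans; [exact Hr' | apply Rmin_l]).
        assert (r < r2) by (eapply Rlt_le_trans; [exact Hr' | apply Rmin_r]).
        unfold G.
        apply (continuous_minus (V := R_NormedModule)).
        + apply (continuous_minus (V := R_NormedModule)).
          * apply (continuous_minus (V := R_NormedModule)); [apply Cphi; lra | apply continuous_const].
          * apply (continuous_mult (K := R_AbsRing)); [apply continuous_const|].
            apply (continuous_minus (V := R_NormedModule)); [apply Cv; lra | apply continuous_const].
        + apply (ex_derive_continuous (V := R_NormedModule)); unfold l; auto_derive; trivial.
      - intros eps Heps.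
        set (M := Rabs a + Rabs b).
        assert (HM : 0 <= M) by (unfold M; generalize (Rabs_pos a) (Rabs_pos b); lra).
        (* [e1] controls the remainder of [phi] and [e2] that of [v]; each
           contributes at most [eps / 2 * r ^ 2]. *)
        set (e1 := eps / (2 * (M + 1) ^ 2)).
        set (e2 := Rmin 1 (eps / ((Rabs l2 + 1) * (2 * M + 1)))).
        assert (Hl2 := Rabs_pos l2).
        assert (He1 : 0 < e1).
        { apply Rdiv_lt_0_compat; trivial. assert (0 < (M + 1) ^ 2) by (apply pow_lt; lra). lra. }
        assert (He2 : 0 < e2).
        { apply Rmin_glb_lt; [lra|]. apply Rdiv_lt_0_compat; trivial. apply Rmult_lt_0_compat; lra. }
        assert (He2' : e2 <= 1) by apply Rmin_l.
        destruct (taylor_second_order phi phi1 (v z) l2 Hphi Hphi1 e1 He1) as (eta & Heta & Ht).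
        destruct (has_grad_circle v z a b Hg e2 He2) as (d & Hd & Hl1).
        exists (Rmin d (eta / (M + 1))); split.
        { apply Rmin_glb_lt; trivial. apply Rdiv_lt_0_compat; lra. }
        intros r t [Hr Hr'].
        assert (Hrd : r < d) by (eapply Rlt_le_trans; [exact Hr' | apply Rmin_l]).
        assert (Hre : r < eta / (M + 1)) by (eapply Rlt_le_trans; [exact Hr' | apply Rmin_r]).
        assert (Hre' : r * (M + 1) < eta).
        { apply Rmult_lt_compat_r with (r := M + 1) in Hre; [|lra].
          unfold Rdiv in Hre; rewrite Rmult_assoc, Rinv_l, Rmult_1_r in Hre; lra. }
        specialize (Hl1 r t (conj Hr Hrd)). fold (l t) in Hl1.
        set (Dv := v (circ z r t) - v z) in *.
        assert (Hlt : Rabs (l t) <= M) by apply linear_form_bound.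
        assert (HDv : Rabs Dv <= r * (M + 1)).
        { replace Dv with (Dv - r * l t + r * l t) by ring.
          eapply Rle_trans; [apply Rabs_triang|]. rewrite (Rabs_mult r), (Rabs_pos_eq r) by lra. nra. }
        assert (Hsq : Rabs (Dv ^ 2 - r ^ 2 * l t ^ 2) <= e2 * (2 * M + 1) * r ^ 2).
        { replace (Dv ^ 2 - r ^ 2 * l t ^ 2) with ((Dv - r * l t) * (Dv + r * l t)) by ring.
          rewrite Rabs_mult.
          replace (e2 * (2 * M + 1) * r ^ 2) with (e2 * r * (r * (M + 1) + r * M)) by ring.
          apply Rmult_le_compat; try apply Rabs_pos; trivial.
          eapply Rle_trans; [apply Rabs_triang|]. apply Rplus_le_compat; trivial.
          rewrite Rabs_mult, Rabs_pos_eq by lra. apply Rmult_le_compat_l; lra. }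
        assert (Htt : Rabs (phi (v (circ z r t)) - phi (v z) - phi1 (v z) * Dv - l2 / 2 * Dv ^ 2)
                      <= e1 * Dv ^ 2) by (apply Ht; unfold Dv in *; lra).
        unfold G. fold Dv.
        replace (phi (v (circ z r t)) - phi (v z) - phi1 (v z) * Dv - l2 / 2 * (r ^ 2 * l t ^ 2))
          with ((phi (v (circ z r t)) - phi (v z) - phi1 (v z) * Dv - l2 / 2 * Dv ^ 2)
                + l2 / 2 * (Dv ^ 2 - r ^ 2 * l t ^ 2)) by field.
        eapply Rle_trans; [apply Rabs_triang|].
        replace (eps * r ^ 2) with (eps / 2 * r ^ 2 + eps / 2 * r ^ 2) by field.
        apply Rplus_le_compat.
        + eapply Rle_trans; [exact Htt|].
          apply Rle_trans with (e1 * (r * (M + 1)) ^ 2).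
          * apply Rmult_le_compat_l; [lra|]. rewrite <- (pow2_abs Dv).
            apply pow_incr; split; [apply Rabs_pos | exact HDv].
          * right; unfold e1; field; lra.
        + rewrite Rabs_mult. unfold Rdiv at 1. rewrite Rabs_mult, (Rabs_pos_eq (/ 2)) by lra.
          apply Rle_trans with (Rabs l2 * / 2 * (e2 * (2 * M + 1) * r ^ 2)).
          * apply Rmult_le_compat_l; [lra | exact Hsq].
          * assert (He2'' : e2 <= eps / ((Rabs l2 + 1) * (2 * M + 1))) by apply Rmin_r.
            apply Rmult_le_compat_r with (r := (Rabs l2 + 1) * (2 * M + 1)) in He2'';
              [|apply Rmult_le_pos; lra].
            unfold Rdiv in He2''; rewrite Rmult_assoc, Rinv_l, Rmult_1_r in He2''
              by (apply Rmult_integral_contrapositive; lra).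
            assert (0 <= r ^ 2) by apply pow2_ge_0.
            assert (0 <= e2 * (2 * M + 1)) by (apply Rmult_le_pos; lra).
            replace (Rabs l2 * / 2 * (e2 * (2 * M + 1) * r ^ 2))
              with (Rabs l2 * (e2 * (2 * M + 1)) / 2 * r ^ 2) by field.
            apply Rmult_le_compat_r; trivial. nra. }
    apply (little_o2_ext (fun r => RInt (G r) 0 (2 * PI) +
        phi1 (v z) * (mean_dev v z r - PI / 2 * L * r ^ 2)) _ (Rmin r1 r2)).
    + apply Rmin_glb_lt; trivial.
    + intros r [Hr Hr'].
      assert (r < r1) by (eapply Rlt_le_trans; [exact Hr' | apply Rmin_l]).
      assert (r < r2) by (eapply Rlt_le_trans; [exact Hr' | apply Rmin_r]).
      generalize PI2_pos; intros Hp.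
      assert (I1 : ex_RInt (fun t => phi (v (circ z r t)) - phi (v z)) 0 (2 * PI)).
      { apply ex_RInt_continuous_le; [lra|]. intros t _.
        apply (continuous_minus (V := R_NormedModule)); [apply Cphi; lra | apply continuous_const]. }
      assert (I2 : ex_RInt (fun t => v (circ z r t) - v z) 0 (2 * PI)).
      { apply ex_RInt_continuous_le; [lra|]. intros t _.
        apply (continuous_minus (V := R_NormedModule)); [apply Cv; lra | apply continuous_const]. }
      apply (RInt_correct (V := R_CompleteNormedModule)) in I1, I2.
      assert (I3 := linear_form_square a b).
      assert (IG : RInt (G r) 0 (2 * PI) = mean_dev (fun w => phi (v w)) z r
         - phi1 (v z) * mean_dev v z r - l2 / 2 * r ^ 2 * (PI * (a ^ 2 + b ^ 2))).
      { apply is_RInt_unique. unfold G, mean_dev.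
        apply (is_RInt_minus (V := R_NormedModule)
          (fun t => phi (v (circ z r t)) - phi (v z) - phi1 (v z) * (v (circ z r t) - v z))
          (fun t => l2 / 2 * (r ^ 2 * l t ^ 2))).
        - apply (is_RInt_minus (V := R_NormedModule)
            (fun t => phi (v (circ z r t)) - phi (v z))); trivial.
          apply (is_RInt_scal (V := R_NormedModule) _ _ _ (phi1 (v z))) in I2. exact I2.
        - apply (is_RInt_scal (V := R_NormedModule) _ _ _ (l2 / 2 * r ^ 2)) in I3.
          eapply is_RInt_ext; [|exact I3]. intros t _.
          unfold scal; simpl; unfold mult, l; simpl. ring. }
      rewrite IG. field.
    + apply little_o2_plus; trivial. apply little_o2_scal; trivial.
Qed.

Lemma jet_plus (v w : C -> R) (z : C) (a b L a' b' L' : R) :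
  jet v z a b L -> jet w z a' b' L' ->
  jet (fun y => v y + w y) z (a + a') (b + b') (L + L').
Proof.
  intros [Hc Hg Hl] [Hc' Hg' Hl'].
  split.
  - destruct Hc as (r1 & R1 & Hc). destruct Hc' as (r2 & R2 & Hc').
    exists (Rmin r1 r2); split; [apply Rmin_glb_lt; trivial|].
    intros y Hy. apply (continuity_2d_pt_plus (fun x y => v (x, y)) (fun x y => w (x, y))).
    + apply Hc. eapply Rlt_le_trans; [exact Hy | apply Rmin_l].
    + apply Hc'. eapply Rlt_le_trans; [exact Hy | apply Rmin_r].
  - intros [eps Heps]. assert (He2 : 0 < eps / 2) by lra.
    destruct (Hg (mkposreal _ He2)) as [[d1 D1] H1].
    destruct (Hg' (mkposreal _ He2)) as [[d2 D2] H2]. simpl in H1, H2.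
    assert (Hmin : 0 < Rmin d1 d2) by (apply Rmin_glb_lt; trivial).
    exists (mkposreal _ Hmin); simpl; intros x y Hx Hy.
    assert (Rmin d1 d2 <= d1) by apply Rmin_l. assert (Rmin d1 d2 <= d2) by apply Rmin_r.
    specialize (H1 x y ltac:(lra) ltac:(lra)). specialize (H2 x y ltac:(lra) ltac:(lra)).
    replace (v (x, y) + w (x, y) - (v (fst z, snd z) + w (fst z, snd z)) -
      ((a + a') * (x - fst z) + (b + b') * (y - snd z))) with
      ((v (x, y) - v (fst z, snd z) - (a * (x - fst z) + b * (y - snd z))) +
       (w (x, y) - w (fst z, snd z) - (a' * (x - fst z) + b' * (y - snd z)))) by ring.
    eapply Rle_trans; [apply Rabs_triang|]. lra.
  - destruct (circle_continuous v z Hc) as (r1 & Hr1 & Cv).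
    destruct (circle_continuous w z Hc') as (r2 & Hr2 & Cw).
    apply (little_o2_ext (fun r => (mean_dev v z r - PI / 2 * L * r ^ 2) +
       (mean_dev w z r - PI / 2 * L' * r ^ 2)) _ (Rmin r1 r2)).
    + apply Rmin_glb_lt; trivial.
    + intros r [Hr Hr'].
      assert (r < r1) by (eapply Rlt_le_trans; [exact Hr' | apply Rmin_l]).
      assert (r < r2) by (eapply Rlt_le_trans; [exact Hr' | apply Rmin_r]).
      generalize PI2_pos; intros Hp.
      assert (E : mean_dev (fun y => v y + w y) z r = mean_dev v z r + mean_dev w z r).
      { unfold mean_dev.
        rewrite <- (RInt_plus (V := R_CompleteNormedModule)).
        - apply RInt_ext. intros t _. unfold plus; simpl; ring.
        - apply ex_RInt_continuous_le; [lra|]. intros t _.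
          apply (continuous_minus (V := R_NormedModule)); [apply Cv; lra | apply continuous_const].
        - apply ex_RInt_continuous_le; [lra|]. intros t _.
          apply (continuous_minus (V := R_NormedModule)); [apply Cw; lra | apply continuous_const]. }
      rewrite E; ring.
    + apply little_o2_plus; trivial.
Qed.

Lemma jet_affine (k c : R) (v : C -> R) (z : C) (a b L : R) :
  jet v z a b L -> jet (fun w => k * v w + c) z (k * a) (k * b) (k * L).
Proof.
  intros H.
  replace (k * L) with (k * L + 0 * (a ^ 2 + b ^ 2)) by ring.
  apply (jet_comp (fun s => k * s + c) (fun _ => k)); trivial.
  - exists 1; split; [lra|]. intros s _; auto_derive; trivial; ring.
  - auto_derive; trivial.
Qed.

(** At a local maximum all circle means are at most the central value. *)
Lemma jet_max (v : C -> R) (z : C) (a b L rho : R) :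
  jet v z a b L -> 0 < rho ->
  (forall w, Cmod (w - z) < rho -> v w <= v z) -> L <= 0.
Proof.
  intros [Hc _ Hl] Hrho Hmax. generalize PI2_pos; intros Hp.
  apply Rnot_lt_le; intros HL.
  destruct (Hl (PI / 4 * L)) as (d & Hd & H); [nra|].
  destruct (circle_continuous v z Hc) as (r1 & Hr1 & Cv).
  set (r := Rmin (Rmin d rho) r1 / 2).
  assert (M1 := Rmin_l (Rmin d rho) r1). assert (M2 := Rmin_r (Rmin d rho) r1).
  assert (M3 := Rmin_l d rho). assert (M4 := Rmin_r d rho).
  assert (Hr : 0 < r) by (unfold r; assert (0 < Rmin (Rmin d rho) r1)
     by (repeat apply Rmin_glb_lt; trivial); lra).
  specialize (H r ltac:(unfold r in *; lra)).
  assert (Hle : mean_dev v z r <= 0).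
  { unfold mean_dev. replace 0 with (RInt (fun _ => 0) 0 (2 * PI)) at 2.
    - apply RInt_le; [lra | | apply ex_RInt_const|].
      + apply ex_RInt_continuous_le; [lra|]. intros t _.
        apply (continuous_minus (V := R_NormedModule)); [apply Cv; unfold r in *; lra | apply continuous_const].
      + intros t _. assert (v (circ z r t) <= v z); [|lra].
        apply Hmax. rewrite Cmod_circ, Rabs_pos_eq; unfold r in *; lra.
    - rewrite RInt_const. unfold scal; simpl; unfold mult; simpl; ring. }
  apply Rabs_le_between in H.
  assert (0 < r ^ 2) by (apply pow_lt; lra).
  assert (0 < PI * L * r ^ 2) by (apply Rmult_lt_0_compat; nra).
  nra.
Qed.

Lemma jet_holomorphic (h d : C -> C) (z : C) :
  (forall w, C_is_derive h w (d w)) ->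
  jet (fun w => fst (h w)) z (fst (d z)) (- snd (d z)) 0 /\
  jet (fun w => snd (h w)) z (snd (d z)) (fst (d z)) 0.
Proof.
  intros Hd.
  assert (Hconj : forall p q : C -> R,
    (forall w, exists a b, has_grad p w a (- b) /\ has_grad q w b a) ->
    continuous_near p z /\ little_o2 (fun r => mean_dev p z r - PI / 2 * 0 * r ^ 2)).
  { intros p q Hpq.
    assert (Hp : forall w, continuity_2d_pt (fun x y => p (x, y)) (fst w) (snd w)).
    { intros w; destruct (Hpq w) as (a & b & Hp & _). eapply has_grad_continuous; exact Hp. }
    assert (Hn : continuous_near p z) by (exists 1; split; [lra | intros; apply Hp]).
    split; trivial.
    intros eps Heps. exists 1; split; [lra|]. intros r Hr.
    assert (E : RInt (fun t => p (circ z r t)) 0 (2 * PI) = 2 * PI * p z).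
    { apply (mean_value p q z 2 r); [lra | intros; apply Hpq |].
      intros e He. destruct (continuity_2d_pt_Cmod p z e (Hp z) He) as (rho & H1 & H2).
      exists rho; split; trivial. intros w Hw; left; apply H2, Hw. }
    unfold mean_dev. rewrite (RInt_minus (V := R_CompleteNormedModule)).
    - rewrite E, RInt_const. unfold minus, plus, opp, scal; simpl; unfold mult; simpl.
      replace (2 * PI * p z + - ((2 * PI - 0) * p z) - PI / 2 * 0 * (r * (r * 1))) with 0 by ring.
      rewrite Rabs_R0. apply Rmult_le_pos; [lra|]. nra.
    - generalize PI2_pos; intros. apply ex_RInt_continuous_le; [lra|].
      intros t _; apply continuous_circ, Hp.
    - apply ex_RInt_const. }
  assert (Hg : forall w, has_grad (fun w => fst (h w)) w (fst (d w)) (- snd (d w)) /\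
                    has_grad (fun w => snd (h w)) w (snd (d w)) (fst (d w))).
  { intros w; apply is_derive_C_has_grad, Hd. }
  destruct (Hg z) as [G1 G2].
  destruct (Hconj (fun w => fst (h w)) (fun w => snd (h w))) as [C1 L1].
  { intros w; exists (fst (d w)), (snd (d w)); apply Hg. }
  destruct (Hconj (fun w => snd (h w)) (fun w => - fst (h w))) as [C2 L2].
  { intros w; exists (snd (d w)), (- fst (d w)). destruct (Hg w) as [H1 H2].
    rewrite Ropp_involutive; split; trivial.
    apply has_grad_opp in H1; rewrite Ropp_involutive in H1; exact H1. }
  split; split; trivial.
Qed.

(** Taylor's formula of order two; the mixed term has mean zero. *)
Lemma jet_smooth (u : C -> R) (z : C) :
  smooth2 u -> exists a b, jet u z a b (laplacian u z).
Proof.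
  intros Hu.
  set (f := fun s t => u (s, t)).
  destruct z as [x0 y0]. 
  destruct (Taylor_Lagrange_2d f 2 x0 y0) as (D & [[d Hd] HT]).
  { exists (mkposreal 1 Rlt_0_1); intros; apply Hu. }
  simpl in HT.
  set (a := partial_derive 1 0 f x0 y0). set (b := partial_derive 0 1 f x0 y0).
  set (xx := partial_derive 2 0 f x0 y0). set (yy := partial_derive 0 2 f x0 y0).
  set (xy := partial_derive 1 1 f x0 y0).
  assert (HT' : forall s t, Rabs s < d -> Rabs t < d ->
     Rabs (f (x0 + s) (y0 + t) - f x0 y0 - (a * s + b * t)
           - (xx / 2 * s ^ 2 + xy * s * t + yy / 2 * t ^ 2)) <=
       Rabs D * Rmax (Rabs s) (Rabs t) ^ 3).
  { intros s t Hs Ht.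
    specialize (HT (x0 + s) (y0 + t)).
    replace (x0 + s - x0) with s in HT by ring. replace (y0 + t - y0) with t in HT by ring.
    specialize (HT Hs Ht).
    eapply Rle_trans; [|eapply Rle_trans; [exact HT|]].
    - right; f_equal. unfold DL_pol, differential; simpl. 
      change (partial_derive 0 0 f x0 y0) with (f x0 y0).
      fold a b xx yy xy. unfold Binomial.C; simpl. field.
    - apply Rmult_le_compat_r; [|apply Rle_abs].
      apply pow_le. eapply Rle_trans; [apply Rabs_pos | apply Rmax_l]. }
  assert (Hcont : forall w : C, continuity_2d_pt (fun x y => u (x, y)) (fst w) (snd w)).
  { intros w; apply (Hu 0%nat). }
  assert (Hnear : continuous_near u (x0, y0)) by (exists 1; split; [lra | intros; apply Hcont]).
  generalize (Rabs_pos D); intros HD.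
  exists a, b; split; trivial.
  - intros [eps Heps].
    set (K := Rabs xx + Rabs xy + Rabs yy).
    assert (HK : 0 <= K) by (unfold K; generalize (Rabs_pos xx) (Rabs_pos xy) (Rabs_pos yy); lra).
    set (e := Rmin (Rmin d 1) (eps / (K + Rabs D + 1))).
    assert (He : 0 < e).
    { repeat apply Rmin_glb_lt; try lra. apply Rdiv_lt_0_compat; lra. }
    assert (M1 := Rmin_l (Rmin d 1) (eps / (K + Rabs D + 1))).
    assert (M2 := Rmin_r (Rmin d 1) (eps / (K + Rabs D + 1))).
    assert (M3 := Rmin_l d 1). assert (M4 := Rmin_r d 1). fold e in M1, M2.
    exists (mkposreal e He); simpl; intros x y Hx Hy.
    specialize (HT' (x - x0) (y - y0) ltac:(lra) ltac:(lra)).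
    replace (x0 + (x - x0)) with x in HT' by ring. replace (y0 + (y - y0)) with y in HT' by ring.
    change (u (x, y)) with (f x y); change (u (x0, y0)) with (f x0 y0).
    set (s := x - x0) in *. set (t := y - y0) in *.
    set (m := Rmax (Rabs s) (Rabs t)) in *.
    assert (Hs : Rabs s <= m) by apply Rmax_l. assert (Ht : Rabs t <= m) by apply Rmax_r.
    assert (Hm : m < e) by (apply Rmax_lub_lt; trivial).
    assert (Hm0 : 0 <= m) by (eapply Rle_trans; [apply Rabs_pos | exact Hs]).
    set (q := xx / 2 * s ^ 2 + xy * s * t + yy / 2 * t ^ 2) in *.
    assert (Hq : Rabs q <= K * m ^ 2).
    { assert (Hst : forall k s t, Rabs s <= m -> Rabs t <= m -> Rabs (k * (s * t)) <= Rabs k * m ^ 2).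
      { intros k s' t' H1 H2. rewrite !Rabs_mult. apply Rmult_le_compat_l; [apply Rabs_pos|].
        replace (m ^ 2) with (m * m) by ring. apply Rmult_le_compat; trivial; apply Rabs_pos. }
      unfold q. eapply Rle_trans; [apply Rabs_triang|].
      eapply Rle_trans; [apply Rplus_le_compat_r, Rabs_triang|].
      generalize (Hst (xx / 2) s s Hs Hs) (Hst xy s t Hs Ht) (Hst (yy / 2) t t Ht Ht).
      unfold Rdiv. rewrite !(Rabs_mult _ (/ 2)), (Rabs_pos_eq (/ 2)) by lra.
      replace (xx * / 2 * s ^ 2) with (xx * / 2 * (s * s)) by ring.
      replace (xy * s * t) with (xy * (s * t)) by ring.
      replace (yy * / 2 * t ^ 2) with (yy * / 2 * (t * t)) by ring.
      assert (0 <= m ^ 2) by apply pow2_ge_0.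
      generalize (Rmult_le_pos _ _ (Rabs_pos xx) H) (Rmult_le_pos _ _ (Rabs_pos yy) H).
      unfold K; lra. }
    replace (f x y - f x0 y0 - (a * s + b * t)) with
      ((f x y - f x0 y0 - (a * s + b * t) - q) + q) by ring.
    eapply Rle_trans; [apply Rabs_triang|].
    assert (Hm3 : m ^ 3 <= m ^ 2).
    { replace (m ^ 3) with (m ^ 2 * m) by ring. rewrite <- (Rmult_1_r (m ^ 2)) at 2.
      apply Rmult_le_compat_l; [apply pow2_ge_0 | lra]. }
    apply Rle_trans with ((K + Rabs D + 1) * m ^ 2).
    + assert (Rabs D * m ^ 3 <= Rabs D * m ^ 2) by (apply Rmult_le_compat_l; trivial).
      generalize (pow2_ge_0 m); lra.
    + replace ((K + Rabs D + 1) * m ^ 2) with (((K + Rabs D + 1) * m) * m) by ring.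
      apply Rmult_le_compat_r; trivial.
      apply Rle_trans with ((K + Rabs D + 1) * (eps / (K + Rabs D + 1))).
      * apply Rmult_le_compat_l; lra.
      * right; field; lra.
  - set (quad := fun r t => r * (a * cos t + b * sin t) + r ^ 2 *
      (xx / 2 * cos t ^ 2 + xy * cos t * sin t + yy / 2 * sin t ^ 2)).
    set (G := fun r t => (u (circ (x0, y0) r t) - u (x0, y0)) - quad r t).
    assert (Hqd : forall r t, ex_derive (quad r) t).
    { intros r t; unfold quad; auto_derive; trivial. }
    assert (Hqc : forall r t, continuous (quad r) t).
    { intros r t. apply (ex_derive_continuous (V := R_NormedModule)), Hqd. }
    assert (Huc : forall r t, continuous (fun t => u (circ (x0, y0) r t) - u (x0, y0)) t).
    { intros r t. apply (continuous_minus (V := R_NormedModule)); [|apply continuous_const].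
      apply continuous_circ, Hcont. }
    apply (little_o2_ext (fun r => RInt (G r) 0 (2 * PI)) _ 1); [lra | |].
    + intros r _. unfold G, mean_dev. generalize PI2_pos; intros Hp.
      rewrite (RInt_minus (V := R_CompleteNormedModule)).
      2:{ apply ex_RInt_continuous_le; [lra | intros; apply Huc]. }
      2:{ apply ex_RInt_continuous_le; [lra | intros; apply Hqc]. }
      replace (RInt (quad r) 0 (2 * PI)) with (PI / 2 * laplacian u (x0, y0) * r ^ 2);
        [reflexivity|].
      symmetry; apply is_RInt_unique. unfold laplacian. fold f. simpl fst; simpl snd. fold xx yy.
      set (F := fun t => r * (a * sin t - b * cos t) + r ^ 2 *
        (xx / 2 * (t / 2 + sin t * cos t / 2) + xy * (sin t ^ 2 / 2)
         + yy / 2 * (t / 2 - sin t * cos t / 2))).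
      replace (PI / 2 * (xx + yy) * r ^ 2) with (minus (F (2 * PI)) (F 0)).
      * apply (is_RInt_derive (V := R_CompleteNormedModule) F); [|intros; apply Hqc].
        intros t _. unfold F, quad. auto_derive; trivial.
        assert (E := sin2_cos2 t); unfold Rsqr in E.
        apply Rminus_diag_uniq.
        transitivity (r ^ 2 * (xx + yy) / 4 * (1 - (sin t * sin t + cos t * cos t)));
          [field | rewrite E; ring].
      * unfold F, minus, plus, opp; simpl. rewrite sin_2PI, cos_2PI, sin_0, cos_0. field.
    + apply little_o2_RInt with 1; [lra | |].
      * intros r _ t. apply (continuous_minus (V := R_NormedModule)); [apply Huc | apply Hqc].
      * intros eps Heps. exists (Rmin d (eps / (Rabs D + 1))); split.
        { apply Rmin_glb_lt; trivial. apply Rdiv_lt_0_compat; lra. }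
        intros r t [Hr Hr'].
        assert (Hrd : r < d) by (eapply Rlt_le_trans; [exact Hr' | apply Rmin_l]).
        assert (Hre : r < eps / (Rabs D + 1)) by (eapply Rlt_le_trans; [exact Hr' | apply Rmin_r]).
        assert (Hc : Rabs (r * cos t) <= r).
        { rewrite Rabs_mult, Rabs_pos_eq by lra. rewrite <- (Rmult_1_r r) at 2.
          apply Rmult_le_compat_l; [lra|]. apply Rabs_le, COS_bound. }
        assert (Hs : Rabs (r * sin t) <= r).
        { rewrite Rabs_mult, Rabs_pos_eq by lra. rewrite <- (Rmult_1_r r) at 2.
          apply Rmult_le_compat_l; [lra|]. apply Rabs_le, SIN_bound. }
        specialize (HT' (r * cos t) (r * sin t) ltac:(lra) ltac:(lra)).
        replace (G r t) with (f (x0 + r * cos t) (y0 + r * sin t) - f x0 y0 -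
          (a * (r * cos t) + b * (r * sin t)) - (xx / 2 * (r * cos t) ^ 2 +
          xy * (r * cos t) * (r * sin t) + yy / 2 * (r * sin t) ^ 2))
          by (unfold G, quad, circ, f; simpl; ring).
        eapply Rle_trans; [exact HT'|].
        assert (Hm : Rmax (Rabs (r * cos t)) (Rabs (r * sin t)) <= r) by (apply Rmax_lub; trivial).
        apply Rle_trans with (Rabs D * r ^ 3).
        { apply Rmult_le_compat_l; trivial. apply pow_incr; split; trivial.
          eapply Rle_trans; [apply Rabs_pos | apply Rmax_l]. }
        replace (Rabs D * r ^ 3) with (Rabs D * r * r ^ 2) by ring.
        apply Rmult_le_compat_r; [apply pow2_ge_0|].
        apply Rle_trans with (Rabs D * (eps / (Rabs D + 1))).
        { apply Rmult_le_compat_l; lra. }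
        replace eps with (eps / (Rabs D + 1) * (Rabs D + 1)) at 2 by (field; lra).
        rewrite Rmult_comm. apply Rmult_le_compat_l; [|lra].
        left; apply Rdiv_lt_0_compat; lra.
Qed.

(** * Ahlfors comparison and entire functions omitting two values *)

Definition sqdist (w c : C) : R := (fst w - fst c) ^ 2 + (snd w - snd c) ^ 2.

Lemma Cmod_sqdist (w c : C) : Cmod (w - c) ^ 2 = sqdist w c.
Proof. rewrite Cmod2_alt; reflexivity. Qed.

Lemma sqdist_pos (w c : C) : w <> c -> 0 < sqdist w c.
Proof.
  intros H. rewrite <- Cmod_sqdist. apply pow_lt, Cmod_gt_0. intros E; apply H.
  replace w with (w - c + c)%C by ring. rewrite E; ring.
Qed.

Lemma jet_sqdist (h d : C -> C) (c z : C) :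
  (forall w, C_is_derive h w (d w)) ->
  exists a b, jet (fun w => sqdist (h w) c) z a b (4 * Cmod (d z) ^ 2) /\
    a ^ 2 + b ^ 2 = 4 * Cmod (d z) ^ 2 * sqdist (h z) c.
Proof.
  intros Hd. destruct (jet_holomorphic h d z Hd) as [Jp Jq].
  assert (Hsq : forall (v : C -> R) (k a b L : R), jet v z a b L ->
     jet (fun w => (v w - k) ^ 2) z (2 * (v z - k) * a) (2 * (v z - k) * b)
       (2 * (v z - k) * L + 2 * (a ^ 2 + b ^ 2))).
  { intros v k a b L J. apply (jet_comp (fun s => (s - k) ^ 2) (fun s => 2 * (s - k)) v z a b L); trivial.
    - exists 1; split; [lra|]. intros s _; auto_derive; trivial; ring.
    - auto_derive; trivial; ring. }
  assert (J := jet_plus _ _ _ _ _ _ _ _ _ (Hsq _ (fst c) _ _ _ Jp) (Hsq _ (snd c) _ _ _ Jq)).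
  do 2 eexists; split.
  - unfold sqdist. rewrite Cmod2_alt. unfold Re, Im.
    match type of J with jet _ _ ?a ?b ?L => 
      replace (4 * (fst (d z) ^ 2 + snd (d z) ^ 2)) with L by ring end.
    exact J.
  - rewrite Cmod2_alt. unfold Re, Im, sqdist. cbv beta; ring.
Qed.

Lemma exp_6 (s : R) : exp (s / 6) ^ 6 = exp s.
Proof.
  simpl. rewrite Rmult_1_r, <- !exp_plus. f_equal; field.
Qed.

(** With [s = ln (|w|^2)] this is the logarithm of
    [(1 + |w|^(1/3))^(1/2) / |w|^(5/6)].  The exponents are those of a metric
    with a mild singularity at [0] that decays fast enough at infinity for its
    product with the translate at [1] to be negatively curved. *)
Definition weight (s : R) : R := / 2 * ln (1 + exp (s / 6)) - 5 / 12 * s.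

Lemma exp_weight (s : R) :
  exp (2 * weight s) = (1 + exp (s / 6)) / exp (s / 6) ^ 5.
Proof.
  generalize (exp_pos (s / 6)); intros Hp.
  replace (2 * weight s) with (ln (1 + exp (s / 6)) + - (s / 6 + s / 6 + s / 6 + s / 6 + s / 6))
    by (unfold weight; field).
  rewrite exp_plus, exp_ln, exp_Ropp, !exp_plus by lra. field. lra.
Qed.

(** As [ln |h - c|] is harmonic, only the second derivative of [weight]
    contributes, multiplied by the square of the gradient of
    [ln (|h - c|^2)]. *)
Lemma jet_weight (h d : C -> C) (c z : C) :
  (forall w, C_is_derive h w (d w)) ->
  h z <> c ->
  let m := exp (ln (sqdist (h z) c) / 6) in
  exists a b, jet (fun w => weight (ln (sqdist (h w) c))) z a b
                  (Cmod (d z) ^ 2 / (18 * (m ^ 5 * (1 + m) ^ 2))).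
Proof.
  intros Hd Hc m. assert (HN := sqdist_pos _ _ Hc).
  destruct (jet_sqdist h d c z Hd) as (a & b & J & E).
  assert (J1 := jet_comp ln Rinv _ z _ _ _ (/ sqdist (h z) c) (- / sqdist (h z) c ^ 2) J).
  lapply J1; [clear J1; intros J1 |].
  2:{ exists (sqdist (h z) c); split; trivial. intros s Hs. apply Rabs_def2 in Hs.
      apply is_derive_Reals. apply derivable_pt_lim_ln. lra. }
  lapply J1; [clear J1; intros J1 | auto_derive; [lra | field; lra]].
  specialize (J1 eq_refl).
  set (phi1 := fun s => / 12 * exp (s / 6) / (1 + exp (s / 6)) - 5 / 12).
  assert (J2 := jet_comp weight phi1 _ z _ _ _
     (phi1 (ln (sqdist (h z) c))) (m / (72 * (1 + m) ^ 2)) J1).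
  assert (Hm : 0 < m) by apply exp_pos.
  lapply J2; [clear J2; intros J2 |].
  2:{ exists 1; split; [lra|]. intros s _. unfold weight, phi1. generalize (exp_pos (s / 6)); intros.
      auto_derive; [lra|]. unfold Rdiv; field. unfold Rdiv in *; lra. }
  lapply J2; [clear J2; intros J2 |].
  2:{ unfold phi1. fold m. auto_derive.
      - change (1 + m <> 0); lra.
      - change (exp (ln (sqdist (h z) c) * / 6)) with m. field. lra. }
  specialize (J2 eq_refl).
  eexists; eexists.
  match type of J2 with jet _ _ _ _ ?L => 
    replace (Cmod (d z) ^ 2 / (18 * (m ^ 5 * (1 + m) ^ 2))) with L end.
  - exact J2.
  - assert (Hm6 : m ^ 6 = sqdist (h z) c).
    { unfold m. rewrite exp_6, exp_ln; trivial. }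
    set (N := sqdist (h z) c) in *.
    replace ((/ N * a) ^ 2 + (/ N * b) ^ 2) with ((a ^ 2 + b ^ 2) / N ^ 2) by (field; lra).
    rewrite E. rewrite <- Hm6. field. lra.
Qed.

(** The larger of [a] and [b], say [b], is at least [3/4] because
    [b^3 >= 1/2]; then [(1 + a)^3 (1 + b) <= (1 + b)^4 <= (7/3 b)^4 <= 40 b^5]. *)
Lemma curvature_bound (a b : R) :
  0 < a -> 0 < b -> 1 <= a ^ 3 + b ^ 3 ->
  (1 + a) / a ^ 5 * ((1 + b) / b ^ 5) <=
  40 * (/ (a ^ 5 * (1 + a) ^ 2) + / (b ^ 5 * (1 + b) ^ 2)).
Proof.
  assert (Hkey : forall a b, 0 < a -> a <= b -> 1 <= a ^ 3 + b ^ 3 ->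
     (1 + a) / a ^ 5 * ((1 + b) / b ^ 5) <= 40 * / (a ^ 5 * (1 + a) ^ 2)).
  { intros x y Hx Hxy H.
    assert (x ^ 3 <= y ^ 3) by (apply pow_incr; lra).
    assert (Hy : 3 / 4 <= y).
    { apply Rnot_lt_le; intros Hlt.
      assert (y ^ 3 <= (3 / 4) ^ 3) by (apply pow_incr; lra). lra. }
    assert (H1 : (1 + y) ^ 4 <= (7 / 3 * y) ^ 4) by (apply pow_incr; lra).
    assert (H2 : (1 + x) ^ 3 <= (1 + y) ^ 3) by (apply pow_incr; lra).
    assert (H3 : 0 < y ^ 4) by (apply pow_lt; lra).
    assert (H4 : (1 + x) ^ 3 * (1 + y) <= 40 * y ^ 5).
    { apply Rle_trans with ((1 + y) ^ 3 * (1 + y)); [apply Rmult_le_compat_r; lra|].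
      replace ((1 + y) ^ 3 * (1 + y)) with ((1 + y) ^ 4) by ring.
      apply Rle_trans with (1 := H1).
      replace ((7 / 3 * y) ^ 4) with (2401 / 81 * y ^ 4) by field.
      replace (40 * y ^ 5) with (40 * y * y ^ 4) by ring. apply Rmult_le_compat_r; lra. }
    assert (H5 : 0 < x ^ 5) by (apply pow_lt; lra).
    assert (H6 : 0 < y ^ 5) by (apply pow_lt; lra).
    assert (H7 : 0 < (1 + x) ^ 2) by (apply pow_lt; lra).
    replace ((1 + x) / x ^ 5 * ((1 + y) / y ^ 5)) with
      ((1 + x) ^ 3 * (1 + y) * / (x ^ 5 * (1 + x) ^ 2 * y ^ 5)) by (field; lra).
    replace (40 * / (x ^ 5 * (1 + x) ^ 2)) with
      (40 * y ^ 5 * / (x ^ 5 * (1 + x) ^ 2 * y ^ 5)) by (field; lra).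
    apply Rmult_le_compat_r; trivial.
    left; apply Rinv_0_lt_compat. repeat apply Rmult_lt_0_compat; trivial; lra. }
  intros Ha Hb H.
  assert (Hpos : forall x, 0 < x -> 0 < / (x ^ 5 * (1 + x) ^ 2)).
  { intros x Hx; apply Rinv_0_lt_compat, Rmult_lt_0_compat; apply pow_lt; lra. }
  generalize (Hpos a Ha) (Hpos b Hb); intros.
  destruct (Rle_lt_dec a b).
  - generalize (Hkey a b Ha r H); lra.
  - generalize (Hkey b a Hb ltac:(lra) ltac:(lra)).
    rewrite (Rmult_comm ((1 + b) / b ^ 5)). lra.
Qed.

Lemma cube_root_modulus (w c : C) : w <> c ->
  exp (ln (sqdist w c) / 6) ^ 3 = Cmod (w - c).
Proof.
  intros H. assert (HN := sqdist_pos _ _ H).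
  assert (E : exp (ln (sqdist w c) / 6) ^ 3 * exp (ln (sqdist w c) / 6) ^ 3 = Cmod (w - c) * Cmod (w - c)).
  { replace (Cmod (w - c) * Cmod (w - c)) with (Cmod (w - c) ^ 2) by ring.
    rewrite Cmod_sqdist. 
    replace (exp (ln (sqdist w c) / 6) ^ 3 * exp (ln (sqdist w c) / 6) ^ 3) with
      (exp (ln (sqdist w c) / 6) ^ 6) by ring.
    rewrite exp_6, exp_ln; trivial. }
  apply Rsqr_inj; trivial.
  - apply pow_le; left; apply exp_pos.
  - apply Cmod_ge_0.
Qed.

(** There is no metric [e^{2v} |dz|^2] on the whole plane with curvature at
    most [-K].  At a maximum of [e^v (rho^2 - |z|^2)] on the disc of radius [rho]
    the Laplacian of [v + ln (rho^2 - |z|^2)] is nonpositive, which bounds this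
    maximum by [2 rho / sqrt K].  Its value at [0] is [e^(v 0) rho^2], which is
    larger for large [rho]. *)
Lemma ahlfors_comparison (v : C -> R) (K : R) :
  0 < K ->
  (forall z, exists a b L, jet v z a b L /\ K * exp (2 * v z) <= L) -> False.
Proof.
  intros HK Hv.
  assert (Hcont : forall z : C, continuity_2d_pt (fun x y => v (x, y)) (fst z) (snd z)).
  { intros z; destruct (Hv z) as (a & b & L & J & _).
    eapply has_grad_continuous, (jet_grad _ _ _ _ _ J). }
  assert (HRR : forall rho, 0 < rho -> K * (exp (2 * v (RtoC 0))) * rho ^ 2 <= 4).
  { intros rho HR.
    set (F := fun x y => exp (v (x, y)) * (rho ^ 2 - sqdist (x, y) (RtoC 0))).
    destruct (max_on_rectangle F (- rho) rho (- rho) rho) as (x & y & Hx & Hy & Hmax); try lra.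
    { intros x y _ _. apply continuity_2d_pt_filterlim.
      apply (continuous_mult (K := R_AbsRing)).
      - apply (continuous_comp (fun u : R * R => v (fst u, snd u)) exp).
        + apply (continuous_pair_comp v); [apply (Hcont (x, y)) | apply continuous_fst | apply continuous_snd].
        + apply continuous_exp.
      - unfold sqdist; simpl.
        apply (continuous_minus (V := R_NormedModule)); [apply continuous_const|].
        apply (continuous_plus (V := R_NormedModule)).
        + apply (continuous_comp (fun u : R * R => fst u) (fun s => (s - 0) * ((s - 0) * 1)));
          [apply continuous_fst | apply (ex_derive_continuous (V := R_NormedModule)); auto_derive; trivial].
        + apply (continuous_comp (fun u : R * R => snd u) (fun s => (s - 0) * ((s - 0) * 1)));
          [apply continuous_snd | apply (ex_derive_continuous (V := R_NormedModule)); auto_derive; trivial]. }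
    set (z := (x, y)).
    set (S := rho ^ 2 - sqdist z (RtoC 0)).
    assert (H0 : exp (v (RtoC 0)) * rho ^ 2 <= exp (v z) * S).
    { eapply Rle_trans; [|apply (Hmax 0 0); lra].
      right; unfold F, sqdist; simpl; unfold RtoC. ring. }
    assert (HS : 0 < S).
    { apply Rnot_le_lt; intros Hneg.
      assert (0 < exp (v (RtoC 0)) * rho ^ 2) by (apply Rmult_lt_0_compat; [apply exp_pos | apply pow_lt; lra]).
      generalize (exp_pos (v z)); intros; nra. }
    destruct (Hv z) as (a & b & L & J & HL).
    destruct (jet_sqdist (fun w => w) (fun _ => RtoC 1) (RtoC 0) z) as (a' & b' & J' & E).
    { intros w; apply is_derive_C_id. }
    rewrite Cmod_1 in J', E.
    assert (J1 := jet_comp (fun s => ln (rho ^ 2 - s)) (fun s => - / (rho ^ 2 - s)) _ z _ _ _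
       (- / S) (- / S ^ 2) J').
    lapply J1; [clear J1; intros J1 |].
    2:{ exists S; split; trivial. intros s Hs. apply Rabs_def2 in Hs.
        auto_derive; [unfold S in *; simpl in *; lra | field; unfold S in *; simpl in *; lra]. }
    lapply J1; [clear J1; intros J1 |].
    2:{ auto_derive; unfold S in *; simpl in *; [lra | field; lra]. }
    specialize (J1 eq_refl).
    assert (J2 := jet_plus _ _ _ _ _ _ _ _ _ J J1).
    (* As [S > 0], the maximum over the square lies in the open disc. *)
    assert (Hz : Cmod z < rho).
    { apply Rsqr_incrst_0; try lra; [|apply Cmod_ge_0].
      replace (Rsqr (Cmod z)) with (Cmod (z - RtoC 0) ^ 2).
      - rewrite Cmod_sqdist. unfold S in HS. unfold Rsqr; simpl in *; lra.
      - replace (z - 0)%C with z by (unfold z; apply injective_projections; simpl; ring). unfold Rsqr; ring. }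
    assert (HL' := jet_max _ z _ _ _ (rho - Cmod z) J2 ltac:(lra)).
    lapply HL'; [clear HL'; intros HL' |].
    2:{ intros w Hw.
        assert (Hwz : Cmod w < rho).
        { replace w with (w - z + z)%C by ring. eapply Rle_lt_trans; [apply Cmod_triangle|]. lra. }
        assert (Hw2 : 0 < rho ^ 2 - sqdist w (RtoC 0)).
        { rewrite <- Cmod_sqdist. replace (w - 0)%C with w by ring.
          generalize (Cmod_ge_0 w); nra. }
        rewrite <- (ln_exp (v w)), <- (ln_exp (v z)), <- !ln_mult by (trivial; apply exp_pos).
        apply ln_le.
        - apply Rmult_lt_0_compat; trivial; apply exp_pos.
        - destruct w as [w1 w2]. apply (Hmax w1 w2).
          + generalize (Rabs_fst_le (w1, w2)); simpl; intros G; apply Rabs_le_between in G. lra.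
          + generalize (Rabs_snd_le (w1, w2)); simpl; intros G. apply Rabs_le_between in G. lra. }
    assert (EL : - / S * (4 * 1 ^ 2) + - / S ^ 2 * (a' ^ 2 + b' ^ 2) = - (4 * rho ^ 2 / S ^ 2)).
    { rewrite E. unfold S. field. unfold S in HS; lra. }
    rewrite EL in HL'.
    assert (HLS : K * exp (2 * v z) * S ^ 2 <= 4 * rho ^ 2).
    { assert (HS2 : 0 < S ^ 2) by (apply pow_lt, HS).
      apply Rmult_le_reg_r with (/ S ^ 2); [apply Rinv_0_lt_compat, HS2|].
      rewrite Rmult_assoc, Rinv_r, Rmult_1_r by lra. unfold Rdiv in HL'. lra. }
    assert (Hexp : forall s, exp (2 * s) = exp s ^ 2).
    { intros s. replace (2 * s) with (s + s) by ring. rewrite exp_plus; ring. }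
    rewrite Hexp in HLS. rewrite Hexp.
    assert (H1 : (exp (v (RtoC 0)) * rho ^ 2) ^ 2 <= (exp (v z) * S) ^ 2).
    { apply pow_incr; split; trivial. apply Rmult_le_pos; [left; apply exp_pos | apply pow2_ge_0]. }
    assert (HR2 : 0 < rho ^ 2) by (apply pow_lt, HR).
    apply Rmult_le_reg_r with (rho ^ 2); trivial.
    apply Rle_trans with (2 := HLS).
    replace (K * exp (v (RtoC 0)) ^ 2 * rho ^ 2 * rho ^ 2) with (K * (exp (v (RtoC 0)) * rho ^ 2) ^ 2) by ring.
    replace (K * exp (v z) ^ 2 * S ^ 2) with (K * (exp (v z) * S) ^ 2) by ring.
    apply Rmult_le_compat_l; lra. }
  set (c := K * exp (2 * v (RtoC 0))) in *.
  assert (Hc : 0 < c) by (apply Rmult_lt_0_compat; [lra | apply exp_pos]).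
  assert (HR : 0 < 1 + 4 / c) by (assert (0 < 4 / c) by (apply Rdiv_lt_0_compat; lra); lra).
  (* Any radius with [c * rho ^ 2 > 4] gives the contradiction. *)
  specialize (HRR (1 + 4 / c) HR).
  assert (E : c * (4 / c) = 4) by (field; lra).
  assert (0 < 4 / c) by (apply Rdiv_lt_0_compat; lra).
  nra.
Qed.

(** The function [v] is the logarithm of the density
    [|g'| (1 + |g|^(1/3))^(1/2) (1 + |g-1|^(1/3))^(1/2) / (|g| |g-1|)^(5/6)];
    with [m0 = |g|^(1/3)] and [m1 = |g - 1|^(1/3)] the curvature estimate
    is [curvature_bound], where [1 <= m0^3 + m1^3] is the triangle
    inequality. *)
Lemma picard_conformal (g d : C -> C) (U : C -> R) :
  (forall z, C_is_derive g z (d z)) ->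
  (forall z, exp (U z) = Cmod (d z)) ->
  (forall z, exists a b, jet U z a b 0) ->
  (forall z, g z <> RtoC 0) -> (forall z, g z <> RtoC 1) -> False.
Proof.
  intros Hd HU HJ H0 H1.
  set (v := fun z => U z + (weight (ln (sqdist (g z) (RtoC 0)))
                          + weight (ln (sqdist (g z) (RtoC 1))))).
  apply (ahlfors_comparison v (/ 720)); [lra|].
  intros z.
  destruct (HJ z) as (a & b & J).
  destruct (jet_weight g d (RtoC 0) z Hd (H0 z)) as (a0 & b0 & J0).
  destruct (jet_weight g d (RtoC 1) z Hd (H1 z)) as (a1 & b1 & J1).
  assert (C0 := cube_root_modulus (g z) (RtoC 0) (H0 z)).
  assert (C1 := cube_root_modulus (g z) (RtoC 1) (H1 z)).
  set (m0 := exp (ln (sqdist (g z) (RtoC 0)) / 6)) in *.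
  set (m1 := exp (ln (sqdist (g z) (RtoC 1)) / 6)) in *.
  do 3 eexists; split; [exact (jet_plus _ _ _ _ _ _ _ _ _ J (jet_plus _ _ _ _ _ _ _ _ _ J0 J1))|].
  unfold v. rewrite !Rmult_plus_distr_l, !exp_plus, !exp_weight. fold m0 m1.
  replace (exp (2 * U z)) with (Cmod (d z) ^ 2)
    by (rewrite <- HU; replace (2 * U z) with (U z + U z) by ring; rewrite exp_plus; ring).
  assert (P0 : 0 < m0) by apply exp_pos. assert (P1 : 0 < m1) by apply exp_pos.
  assert (T : 1 <= m0 ^ 3 + m1 ^ 3).
  { rewrite C0, C1. apply Rle_trans with (Cmod (RtoC 1)); [rewrite Cmod_1; apply Rle_refl|].
    replace (RtoC 1) with ((g z - 0) + - (g z - 1))%C at 1 by ring.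
    eapply Rle_trans; [apply Cmod_triangle|]. rewrite Cmod_opp; lra. }
  assert (B := curvature_bound m0 m1 P0 P1 T).
  assert (HD : 0 <= Cmod (d z) ^ 2) by apply pow2_ge_0.
  apply Rmult_le_compat_l with (r := Cmod (d z) ^ 2 / 720) in B; [|lra].
  replace (/ 720 * (Cmod (d z) ^ 2 * ((1 + m0) / m0 ^ 5 * ((1 + m1) / m1 ^ 5))))
    with (Cmod (d z) ^ 2 / 720 * ((1 + m0) / m0 ^ 5 * ((1 + m1) / m1 ^ 5)))
    by (field; lra).
  apply Rle_trans with (1 := B). right; field. lra.
Qed.

(** * The chart 1 / (f - c) and omitted values *)

Definition inv_chart (f : C -> option C) (c z : C) : C :=
  match f z with Some w => (/ (w - c))%C | None => RtoC 0 end.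

(** This is [|h|^2 + |1 + c h|^2] after completing the square, which lets
    [jet_sqdist] compute its Laplacian.  In the coordinate [h = 1 / (w - c)] the
    round metric is [2 |dh|] divided by this quantity. *)
Definition inv_chart_density (c h : C) : R :=
  (1 + Cmod c ^ 2) * sqdist h (- (Cconj c) / RtoC (1 + Cmod c ^ 2))%C + / (1 + Cmod c ^ 2).

Lemma inv_chart_density_eq (c w : C) : w <> c ->
  inv_chart_density c (/ (w - c))%C = (1 + Cmod w ^ 2) / Cmod (w - c) ^ 2.
Proof.
  intros Hwc. assert (Hp := sqdist_pos _ _ Hwc).
  rewrite Cmod_sqdist.
  unfold inv_chart_density. rewrite !Cmod2_alt.
  destruct c as [c1 c2], w as [w1 w2]. unfold sqdist in *. simpl in *.
  assert (0 < 1 + (c1 * (c1 * 1) + c2 * (c2 * 1))) by nra.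
  field. repeat split; try lra.
Qed.

Lemma inv_chart_density_pos (c h : C) : 0 < inv_chart_density c h.
Proof.
  unfold inv_chart_density. assert (0 <= Cmod c ^ 2) by apply pow2_ge_0.
  assert (0 < / (1 + Cmod c ^ 2)) by (apply Rinv_0_lt_compat; lra).
  assert (0 <= sqdist h (- (Cconj c) / RtoC (1 + Cmod c ^ 2))%C).
  { rewrite <- Cmod_sqdist; apply pow2_ge_0. }
  assert (0 <= (1 + Cmod c ^ 2) * sqdist h (- (Cconj c) / RtoC (1 + Cmod c ^ 2))%C)
    by (apply Rmult_le_pos; lra).
  lra.
Qed.

Lemma ex_derive_C_derive (h : C -> C) (z d : C) :
  C_is_derive h z d ->
  C_is_derive h z (C_derive h z).
Proof. intros H. rewrite (is_C_derive_unique _ _ _ H). exact H. Qed.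

Lemma finite_part_derive (f : C -> option C) (z : C) :
  meromorphic f -> f z <> None ->
  C_is_derive (finite_part f) z
    (C_derive (finite_part f) z) /\
  exists r, 0 < r /\ forall w, Cmod (w - z) < r -> f w <> None.
Proof.
  intros Hm Hz. destruct (Hm z) as [H|[H _]]; [|contradiction].
  split.
  - apply locally_singleton in H. destruct H as [_ [d Hd]].
    exact (ex_derive_C_derive _ _ _ Hd).
  - apply locally_Cmod in H. destruct H as (r & Hr & H).
    exists r; split; trivial. intros w Hw; apply H, Hw.
Qed.

(** Liouville's formula in the coordinate [1 / (f - c)]. *)
Lemma inv_chart_finite (u : C -> R) (f : C -> option C) (c z w : C) :
  developing_function u f -> f z = Some w -> w <> c ->
  exists d, C_is_derive (inv_chart f c) z d /\
    exp (u z) * inv_chart_density c (inv_chart f c z) = 2 * Cmod d.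
Proof.
  intros (Hm & _ & H0 & Hu) Hz Hwc.
  assert (Hfin : f z <> None) by (rewrite Hz; discriminate).
  destruct (finite_part_derive f z Hm Hfin) as (Hd & r & Hr & Hnear).
  assert (Hwc' : (w - c)%C <> 0).
  { intros E; apply Hwc. replace w with (w - c + c)%C by ring. rewrite E; ring. }
  specialize (H0 z Hfin). specialize (Hu z Hfin).
  set (F := finite_part f) in *. set (D := C_derive F z) in *.
  assert (HF : F z = w) by (unfold F, finite_part; rewrite Hz; reflexivity).
  exists (- (D / ((w - c) * (w - c))))%C. split.
  - apply (is_derive_ext_loc (K := C_AbsRing) (V := C_NormedModule)
      (fun w => (RtoC 1 / (F w - c))%C)).
    + apply locally_C, locally_Cmod. exists r; split; trivial. intros y Hy.
      specialize (Hnear y Hy). unfold F, inv_chart, finite_part.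
      destruct (f y); [|congruence]. unfold Cdiv; rewrite Cmult_1_l; reflexivity.
    + replace (- (D / ((w - c) * (w - c))))%C with
        (((RtoC 0) * (F z - c) - RtoC 1 * D) / ((F z - c) * (F z - c)))%C.
      * apply (is_derive_Cdiv (fun _ => RtoC 1) (fun w => F w - c)%C).
        -- apply is_derive_C_const.
        -- apply is_derive_C_minus_const, Hd.
        -- rewrite HF; exact Hwc'.
      * rewrite HF. field. exact Hwc'.
  - unfold inv_chart; rewrite Hz, inv_chart_density_eq by trivial.
    rewrite Cmod_opp, Cmod_div, Cmod_mult by (apply Cmult_neq_0; exact Hwc').
    rewrite HF in Hu.
    assert (HD : 0 < Cmod D) by (apply Cmod_gt_0; exact H0).
    assert (HW : 0 < Cmod (w - c)) by (apply Cmod_gt_0; exact Hwc').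
    assert (0 <= Cmod w ^ 2) by apply pow2_ge_0.
    rewrite Hu, exp_ln by (apply Rdiv_lt_0_compat; lra).
    field. lra.
Qed.

(** If [(w - z) f w] tends to [res], then [1 / (f w - c)] is asymptotic to
    [(w - z) / res], so a simple pole becomes a regular point with derivative
    [1 / res]. *)
Lemma inv_chart_pole (f : C -> option C) (c z : C) :
  simple_pole_at f z ->
  (exists d, C_is_derive (inv_chart f c) z d) /\
  exists rho, 0 < rho /\ forall w, 0 < Cmod (w - z) < rho -> f w <> None /\ f w <> Some c.
Proof.
  intros ((Hz & Hdiff & Hinf) & res & Hres & Hlim).
  assert (Hm : 0 < Cmod res) by (apply Cmod_gt_0; exact Hres).
  set (m := Cmod res) in *.
  assert (Hlim' : forall eta, 0 < eta -> exists rho, 0 < rho /\ forall w,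
     0 < Cmod (w - z) < rho ->
     exists k, f w = Some k /\ Cmod ((w - z) * (k - c) - res) < eta).
  { intros eta Heta.
    assert (Heta2 : 0 < eta / 2) by lra.
    assert (L1 : locally' z (fun w => Cmod ((w - z) * finite_part f w - res) < eta / 2)).
    { apply (Hlim (fun y => Cmod (y - res) < eta / 2)).
      apply locally_Cmod. exists (eta / 2); split; trivial. }
    apply locally_Cmod in L1. destruct L1 as (r1 & R1 & L1).
    apply locally_Cmod in Hdiff. destruct Hdiff as (r2 & R2 & L2).
    assert (Hc := Cmod_ge_0 c).
    set (r3 := eta / (2 * (Cmod c + 1))).
    assert (R3 : 0 < r3) by (apply Rdiv_lt_0_compat; lra).
    exists (Rmin r3 (Rmin r1 r2)); split; [repeat apply Rmin_glb_lt; trivial|].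
    intros w [Hw0 Hw].
    assert (M1 := Rmin_l r3 (Rmin r1 r2)). assert (M2 := Rmin_r r3 (Rmin r1 r2)).
    assert (M3 := Rmin_l r1 r2). assert (M4 := Rmin_r r1 r2).
    assert (Hne : w <> z).
    { intros E; rewrite E in Hw0. unfold Cminus in Hw0; rewrite Cplus_opp_r, Cmod_0 in Hw0; lra. }
    specialize (L1 w ltac:(lra) Hne). destruct (L2 w ltac:(lra) Hne) as [L3 _].
    unfold finite_part in L1. destruct (f w) as [k|]; [|congruence].
    exists k; split; trivial.
    replace ((w - z) * (k - c) - res)%C with (((w - z) * k - res) + - ((w - z) * c))%C by ring.
    eapply Rle_lt_trans; [apply Cmod_triangle|]. rewrite Cmod_opp, Cmod_mult.
    assert (Cmod (w - z) * Cmod c <= r3 * (Cmod c + 1)) by (apply Rmult_le_compat; lra).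
    replace (r3 * (Cmod c + 1)) with (eta / 2) in H by (unfold r3; field; lra). lra. }
  split.
  - exists (/ res)%C. apply is_derive_C_eps. intros eps Heps.
    destruct (Hlim' (Rmin (m / 2) (eps * m * m / 2))) as (rho & Hrho & Hl).
    { apply Rmin_glb_lt; [lra|]. assert (0 < eps * m * m) by (repeat apply Rmult_lt_0_compat; lra). lra. }
    exists rho; split; trivial. intros w Hw.
    destruct (Req_dec (Cmod (w - z)) 0) as [E|E].
    { apply Cmod_eq_0 in E. replace w with z by (replace w with (w - z + z)%C by ring; rewrite E; ring).
      replace (inv_chart f c z - inv_chart f c z - / res * (z - z))%C with (RtoC 0) by ring.
      rewrite Cmod_0. apply Rmult_le_pos; [lra | apply Cmod_ge_0]. }
    assert (Hpos : 0 < Cmod (w - z)) by (generalize (Cmod_ge_0 (w - z)); lra).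
    destruct (Hl w (conj Hpos Hw)) as (k & Ek & Hk).
    set (M := ((w - z) * (k - c))%C) in *.
    assert (K1 : Cmod (M - res) < m / 2) by (eapply Rlt_le_trans; [exact Hk | apply Rmin_l]).
    assert (K2 : Cmod (M - res) < eps * m * m / 2) by (eapply Rlt_le_trans; [exact Hk | apply Rmin_r]).
    assert (HM : m / 2 <= Cmod M).
    { assert (T := Cmod_triangle M (- (M - res))).
      replace (M + - (M - res))%C with res in T by ring. rewrite Cmod_opp in T. fold m in T. lra. }
    assert (HM0 : M <> 0) by (apply Cmod_gt_0; lra).
    assert (Hwz : (w - z)%C <> 0) by (apply Cmod_gt_0; lra).
    assert (Hkc : (k - c)%C <> 0).
    { intros E'. apply HM0. unfold M; rewrite E'; ring. }
    unfold inv_chart. rewrite Ek, Hz.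
    replace (/ (k - c) - 0 - / res * (w - z))%C with ((w - z) * (- (M - res) / (M * res)))%C
      by (unfold M; field; repeat split; assumption).
    rewrite Cmod_mult, Rmult_comm. apply Rmult_le_compat_r; [lra|].
    rewrite Cmod_div, Cmod_opp, Cmod_mult by (apply Cmult_neq_0; assumption). fold m.
    assert (HMm : 0 < Cmod M * m) by (apply Rmult_lt_0_compat; lra).
    apply Rmult_le_reg_r with (Cmod M * m); trivial.
    unfold Rdiv; rewrite Rmult_assoc, Rinv_l, Rmult_1_r by lra.
    apply Rle_trans with (eps * m * (m / 2)); [lra|].
    replace (eps * (Cmod M * m)) with (eps * m * Cmod M) by ring.
    apply Rmult_le_compat_l; [apply Rmult_le_pos|]; lra.
  - destruct (Hlim' m Hm) as (rho & Hrho & Hl). exists rho; split; trivial.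
    intros w Hw. destruct (Hl w Hw) as (k & Ek & Hk). rewrite Ek; split; [discriminate|].
    intros E; injection E as ->. replace ((w - z) * (c - c) - res)%C with (- res)%C in Hk by ring.
    rewrite Cmod_opp in Hk. fold m in Hk. lra.
Qed.

(** Liouville's formula at a pole follows from the formula at nearby points,
    since [u] is continuous and so is the derivative of
    [1 / (f - c)] along a line, by [derivative_continuous]. *)
Lemma inv_chart_metric (u : C -> R) (f : C -> option C) (c z : C) :
  smooth2 u -> developing_function u f -> f z <> Some c ->
  exists d, C_is_derive (inv_chart f c) z d /\
    exp (u z) * inv_chart_density c (inv_chart f c z) = 2 * Cmod d.
Proof.
  intros Hsm Hdev Hc. destruct (f z) as [w|] eqn:Ez.
  { apply inv_chart_finite with w; trivial. congruence. }
  assert (Hsp : simple_pole_at f z).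
  { destruct Hdev as (Hm & Hp & _). apply Hp. destruct (Hm z) as [H|H]; trivial.
    apply locally_singleton in H. destruct H; congruence. }
  destruct (inv_chart_pole f c z Hsp) as ((d0 & Hd0) & rho & Hrho & Hnear).
  set (h := inv_chart f c) in *. set (d := C_derive h).
  assert (Hpunct : forall w, 0 < Cmod (w - z) < rho ->
    C_is_derive h w (d w) /\
    exp (u w) * inv_chart_density c (h w) = 2 * Cmod (d w)).
  { intros w Hw. destruct (Hnear w Hw) as [N1 N2].
    destruct (f w) as [k|] eqn:Ew; [|congruence].
    destruct (inv_chart_finite u f c w k Hdev Ew) as (e & He & Eq); [congruence|].
    rewrite (is_C_derive_unique _ _ _ He : d w = e). split; trivial. }
  assert (Hall : forall w, Cmod (w - z) < rho ->
    C_is_derive h w (d w)).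
  { intros w Hw. destruct (Req_dec (Cmod (w - z)) 0) as [E|E].
    - apply Cmod_eq_0 in E. replace w with z by (replace w with (w - z + z)%C by ring; rewrite E; ring).
      exact (ex_derive_C_derive _ _ _ Hd0).
    - apply Hpunct. generalize (Cmod_ge_0 (w - z)); lra. }
  assert (Hz0 : Cmod (z - z) < rho) by (unfold Cminus; rewrite Cplus_opp_r, Cmod_0; lra).
  exists (d z); split; [apply Hall, Hz0|].
  (* Off the pole [E] is [2 |d|]; both are continuous at [0]. *)
  set (E := fun s : R => exp (u (z + RtoC s)%C) * inv_chart_density c (h (z + RtoC s)%C)).
  assert (HE : continuous E 0).
  { assert (Hline : forall v : C -> R, continuity_2d_pt (fun x y => v (x, y)) (fst z) (snd z) ->
       continuous (fun s : R => v (z + RtoC s)%C) 0).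
    { intros v Hv. apply continuity_2d_pt_filterlim in Hv.
      apply (continuous_comp_2 (fun s => fst z + s) (fun s => snd z + 0) (fun x y => v (x, y))).
      - apply (ex_derive_continuous (V := R_NormedModule)); auto_derive; trivial.
      - apply continuous_const.
      - rewrite !Rplus_0_r. exact Hv. }
    destruct (is_derive_C_has_grad h z (d z) (Hall z Hz0)) as [G1 G2].
    apply has_grad_continuous, (Hline (fun w => fst (h w))) in G1.
    apply has_grad_continuous, (Hline (fun w => snd (h w))) in G2.
    apply (continuous_mult (K := R_AbsRing)).
    - apply (continuous_comp (fun s : R => u (z + RtoC s)%C) exp); [|apply continuous_exp].
      apply Hline. apply (Hsm 0%nat).
    - assert (Hsq : forall (k : R) (g : R -> R), continuous g 0 ->
         continuous (fun s => (g s - k) ^ 2) 0).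
      { intros k g Hg. apply (continuous_comp g (fun s => (s - k) ^ 2)); trivial.
        apply (ex_derive_continuous (V := R_NormedModule)); auto_derive; trivial. }
      unfold inv_chart_density, sqdist.
      apply (continuous_plus (V := R_NormedModule)); [|apply continuous_const].
      apply (continuous_mult (K := R_AbsRing)); [apply continuous_const|].
      apply (continuous_plus (V := R_NormedModule));
        [apply (Hsq _ _ G1) | apply (Hsq _ _ G2)]. }
  apply cond_eq. intros eps Heps.
  destruct (derivative_continuous h d z rho Hrho Hall (eps / 8)) as (d1 & D1 & Hcd); [lra|].
  assert (Heps2 : 0 < eps / 2) by lra.
  destruct (proj1 (filterlim_locally E (E 0)) HE (mkposreal _ Heps2)) as [[d2 D2] HcE].
  simpl in HcE.
  set (s := Rmin rho (Rmin d1 d2) / 2).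
  assert (M1 := Rmin_l rho (Rmin d1 d2)). assert (M2 := Rmin_r rho (Rmin d1 d2)).
  assert (M3 := Rmin_l d1 d2). assert (M4 := Rmin_r d1 d2).
  assert (Hmin : 0 < Rmin rho (Rmin d1 d2)) by (repeat apply Rmin_glb_lt; trivial).
  assert (Hs : 0 < s) by (unfold s; lra).
  assert (Habs : Rabs s = s) by (apply Rabs_pos_eq; lra).
  specialize (Hcd s ltac:(rewrite Habs; unfold s; lra)).
  assert (HEs : Rabs (E s - E 0) < eps / 2).
  { apply HcE. change (Rabs (s - 0) < d2). rewrite Rminus_0_r, Habs. unfold s; lra. }
  assert (Es : E s = 2 * Cmod (d (z + RtoC s)%C)).
  { apply Hpunct. replace (z + s - z)%C with (RtoC s) by ring.
    rewrite Cmod_R, Habs. unfold s in *; lra. }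
  assert (E0 : E 0 = exp (u z) * inv_chart_density c (h z)).
  { unfold E. replace (z + RtoC 0)%C with z by ring. reflexivity. }
  rewrite <- E0.
  assert (T1 := Cmod_triangle (d (z + RtoC s)%C - d z) (d z)).
  replace (d (z + RtoC s)%C - d z + d z)%C with (d (z + RtoC s)%C) in T1 by ring.
  assert (T2 := Cmod_triangle (- (d (z + RtoC s)%C - d z)) (d (z + RtoC s)%C)).
  rewrite Cmod_opp in T2.
  replace (- (d (z + RtoC s)%C - d z) + d (z + RtoC s)%C)%C with (d z) in T2 by ring.
  apply Rabs_def2 in HEs. apply Rabs_def1; lra.
Qed.

Lemma Cinv_minus_inj (w a c : C) : w <> c -> a <> c -> (/ (w - c) = / (a - c))%C -> w = a.
Proof.
  intros Hw Ha E.
  assert (Hw' : (w - c)%C <> 0).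
  { intros E'; apply Hw. replace w with (w - c + c)%C by ring. rewrite E'; ring. }
  assert (Ha' : (a - c)%C <> 0).
  { intros E'; apply Ha. replace a with (a - c + c)%C by ring. rewrite E'; ring. }
  assert (E2 : (w - c)%C = (a - c)%C).
  { replace (w - c)%C with (/ / (w - c))%C by (field; trivial).
    rewrite E. field; trivial. }
  replace w with (w - c + c)%C by ring. rewrite E2; ring.
Qed.

Lemma inv_chart_omits (f : C -> option C) (a c z : C) :
  a <> c -> f z <> Some a -> f z <> Some c -> inv_chart f c z <> (/ (a - c))%C.
Proof.
  intros Hac Ha Hc E. unfold inv_chart in E. destruct (f z) as [w|].
  - apply Ha. f_equal. apply (Cinv_minus_inj w a c); trivial. congruence.
  - assert (Ha' : (a - c)%C <> 0).
    { intros E'; apply Hac. replace a with (a - c + c)%C by ring. rewrite E'; ring. }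
    apply (f_equal (Cmult (a - c)%C)) in E.
    rewrite Cinv_r in E by trivial. rewrite Cmult_0_r in E.
    apply RtoC_inj in E. lra.
Qed.

(** The round metric has curvature 1: the Laplacian of the logarithm of its
    density is minus the square of the density. *)
Lemma jet_log_density (h d : C -> C) (c z : C) :
  (forall w, C_is_derive h w (d w)) ->
  exists a b, jet (fun w => ln (inv_chart_density c (h w))) z a b
    ((2 * Cmod (d z) / inv_chart_density c (h z)) ^ 2).
Proof.
  intros Hd. 
  set (kappa := 1 + Cmod c ^ 2).
  assert (Hk : 0 < kappa) by (unfold kappa; generalize (pow2_ge_0 (Cmod c)); lra).
  set (c0 := (- (Cconj c) / RtoC kappa)%C).
  destruct (jet_sqdist h d c0 z Hd) as (a & b & J & E).
  assert (HQ := inv_chart_density_pos c (h z)).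
  set (Q := inv_chart_density c (h z)) in *.
  assert (EQ : Q = kappa * sqdist (h z) c0 + / kappa) by reflexivity.
  assert (J1 := jet_comp (fun s => ln (kappa * s + / kappa)) (fun s => kappa / (kappa * s + / kappa))
    _ z _ _ _ (kappa / Q) (- kappa ^ 2 / Q ^ 2) J).
  lapply J1; [clear J1; intros J1 |].
  2:{ exists (Q / kappa); split; [apply Rdiv_lt_0_compat; trivial|].
      intros s Hs. apply Rabs_def2 in Hs. 
      assert (0 < kappa * s + / kappa).
      { replace (kappa * s + / kappa) with (kappa * (s - sqdist (h z) c0) + Q) by (rewrite EQ; ring).
        destruct Hs as [_ Hs]. apply Rmult_lt_compat_l with (r := kappa) in Hs; trivial.
        replace (kappa * - (Q / kappa)) with (- Q) in Hs by (field; lra). lra. }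
      auto_derive; [trivial | unfold Rdiv; ring]. }
  lapply J1; [clear J1; intros J1 |].
  2:{ auto_derive; rewrite <- ?EQ; [lra |]. field; lra. }
  specialize (J1 ltac:(cbv beta; rewrite <- EQ; reflexivity)).
  do 2 eexists. 
  match type of J1 with jet _ _ _ _ ?L => 
    replace ((2 * Cmod (d z) / Q) ^ 2) with L; [exact J1|] end.
  rewrite E.
  replace (sqdist (h z) c0) with ((Q - / kappa) / kappa) by (rewrite EQ; field; lra).
  field; lra.
Qed.

(** For [h = 1 / (f - c)], [jet_log_density] and the equation for [u] show that
    [u + ln (inv_chart_density c h)], which is [ln |2 h'|], is harmonic. *)
Lemma picard_three_values (u : C -> R) (f : C -> option C) (a b c : C) :
  smooth2 u -> (forall z, laplacian u z + exp (2 * u z) = 0) ->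
  developing_function u f ->
  a <> b -> a <> c -> b <> c ->
  (forall z, f z <> Some a) -> (forall z, f z <> Some b) -> (forall z, f z <> Some c) ->
  False.
Proof.
  intros Hsm Heq Hdev Hab Hac Hbc Fa Fb Fc.
  set (h := inv_chart f c). set (d := C_derive h).
  assert (Hh : forall z, C_is_derive h z (d z) /\
     exp (u z) * inv_chart_density c (h z) = 2 * Cmod (d z)).
  { intros z. destruct (inv_chart_metric u f c z Hsm Hdev (Fc z)) as (e & He & E).
    rewrite (is_C_derive_unique _ _ _ He : d z = e). split; trivial. }
  set (a' := (/ (a - c))%C). set (b' := (/ (b - c))%C). set (k := (b' - a')%C).
  assert (Hk : k <> 0).
  { intros E; apply Hab, (Cinv_minus_inj a b c); trivial. fold a' b'.
    replace b' with (k + a')%C by (unfold k; ring). rewrite E; ring. }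
  assert (Hk' : 0 < Cmod k) by (apply Cmod_gt_0; exact Hk).
  apply (picard_conformal (fun z => (h z - a') / k)%C (fun z => d z / k)%C
    (fun z => u z + (1 * ln (inv_chart_density c (h z)) + - ln (2 * Cmod k)))).
  - intros z. replace (d z / k)%C with ((d z * k - (h z - a') * RtoC 0) / (k * k))%C
      by (field; exact Hk).
    apply (is_derive_Cdiv (fun z => h z - a')%C (fun _ => k)).
    + apply is_derive_C_minus_const, Hh.
    + apply is_derive_C_const.
    + exact Hk.
  - intros z. destruct (Hh z) as [_ E].
    rewrite !exp_plus, Rmult_1_l, exp_ln, exp_Ropp, exp_ln
      by (first [apply inv_chart_density_pos | lra]).
    rewrite Cmod_div by exact Hk. rewrite <- Rmult_assoc, E. field. lra.
  - intros z.
    destruct (jet_smooth u z Hsm) as (a1 & b1 & J1).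
    destruct (jet_log_density h d c z (fun w => proj1 (Hh w))) as (a2 & b2 & J2).
    assert (J := jet_plus _ _ _ _ _ _ _ _ _ J1 (jet_affine 1 (- ln (2 * Cmod k)) _ _ _ _ _ J2)).
    do 2 eexists.
    match type of J with jet _ _ _ _ ?L => replace 0 with L; [exact J|] end.
    destruct (Hh z) as [_ E]. rewrite <- E.
    assert (HQ := inv_chart_density_pos c (h z)).
    replace (exp (u z) * inv_chart_density c (h z) / inv_chart_density c (h z))
      with (exp (u z)) by (field; lra).
    specialize (Heq z). replace (2 * u z) with (u z + u z) in Heq by ring.
    rewrite exp_plus in Heq. simpl; lra.
  - intros z E.
    apply (inv_chart_omits f a c z); trivial. fold h a'.
    replace (h z) with ((h z - a') / k * k + a')%C by (field; exact Hk).
    rewrite E; ring.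
  - intros z E.
    apply (inv_chart_omits f b c z); trivial. fold h b'.
    replace (h z) with ((h z - a') / k * k + a')%C by (field; exact Hk).
    rewrite E; unfold k; ring.
Qed.

(** * Distances in the pulled back metric *)

(** The scalar product of the stereographic lifts of [A] and [w], hence the
    cosine of their spherical distance. *)
Definition height (A w : C) : R :=
  ((1 - Cmod A ^ 2) * (1 - Cmod w ^ 2) + 4 * (fst A * fst w + snd A * snd w))
  / ((1 + Cmod A ^ 2) * (1 + Cmod w ^ 2)).

Definition cosine (f : C -> option C) (A z : C) : R :=
  match f z with
  | Some w => height A w
  | None => - (1 - Cmod A ^ 2) / (1 + Cmod A ^ 2)
  end.

(** The partial derivative of [height] with respect to the first coordinate of
    [w]; exchanging the two coordinates gives the other one. *)
Definition height_dx (a1 a2 x y : R) : R :=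
  ((- 2 * x * (1 - (a1 ^ 2 + a2 ^ 2)) + 4 * a1) * (1 + (x ^ 2 + y ^ 2))
   - 2 * x * ((1 - (a1 ^ 2 + a2 ^ 2)) * (1 - (x ^ 2 + y ^ 2)) + 4 * (a1 * x + a2 * y)))
  / ((1 + (a1 ^ 2 + a2 ^ 2)) * (1 + (x ^ 2 + y ^ 2)) ^ 2).

(** The cosine of the distance to a point of the unit sphere has gradient of
    norm [sqrt (1 - height^2)] for the round metric [4 |dw|^2 / (1 + |w|^2)^2]. *)
Lemma height_gradient (a1 a2 x y : R) :
  height_dx a1 a2 x y ^ 2 + height_dx a2 a1 y x ^ 2 =
  4 * (1 - height (a1, a2) (x, y) ^ 2) / (1 + (x ^ 2 + y ^ 2)) ^ 2.
Proof.
  unfold height, height_dx. rewrite !Cmod2_alt. simpl Re; simpl Im; simpl fst; simpl snd.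
  assert (0 < 1 + (a1 ^ 2 + a2 ^ 2)) by nra. assert (0 < 1 + (x ^ 2 + y ^ 2)) by nra.
  field. repeat split; nra.
Qed.

Lemma height_bound (A w : C) : height A w ^ 2 <= 1.
Proof.
  destruct A as [a1 a2], w as [x y].
  assert (E := height_gradient a1 a2 x y).
  assert (H : 0 < (1 + (x ^ 2 + y ^ 2)) ^ 2) by (apply pow_lt; nra).
  assert (0 <= 4 * (1 - height (a1, a2) (x, y) ^ 2) / (1 + (x ^ 2 + y ^ 2)) ^ 2).
  { rewrite <- E. apply Rplus_le_le_0_compat; apply pow2_ge_0. }
  apply Rmult_le_compat_r with (r := (1 + (x ^ 2 + y ^ 2)) ^ 2) in H0; [|lra].
  unfold Rdiv in H0. rewrite Rmult_assoc, Rinv_l in H0 by lra. lra.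
Qed.

(** The Cauchy-Schwarz inequality for the gradient computed in
    [height_gradient]; [rho] is the conformal factor at [sigma t]. *)
Lemma height_along_curve (A : C) (k : C -> C) (sigma : R -> C) (t s1 s2 rho : R) (d : C) :
  C_is_derive k (sigma t) d ->
  rho * (1 + Cmod (k (sigma t)) ^ 2) = 2 * Cmod d ->
  is_derive (fun t => fst (sigma t)) t s1 ->
  is_derive (fun t => snd (sigma t)) t s2 ->
  exists l : R, is_derive (fun t => height A (k (sigma t))) t l /\
    l ^ 2 <= (1 - height A (k (sigma t)) ^ 2) * (rho * Cmod (s1, s2)) ^ 2.
Proof.
  intros Hk Hrho H1 H2.
  destruct (is_derive_C_has_grad k (sigma t) d Hk) as [G1 G2].
  set (x := fun t => fst (k (sigma t))). set (y := fun t => snd (k (sigma t))).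
  assert (Hx : is_derive x t (fst d * s1 + - snd d * s2)).
  { apply is_derive_Reals. apply is_derive_Reals in H1, H2.
    assert (T := derivable_pt_lim_comp_2d _ _ _ _ _ _ _ _ G1 H1 H2).
    intros eps Heps; destruct (T eps Heps) as [delta Hd]; exists delta.
    intros r Hr0 Hr; specialize (Hd r Hr0 Hr). rewrite <- !surjective_pairing in Hd. exact Hd. }
  assert (Hy : is_derive y t (snd d * s1 + fst d * s2)).
  { apply is_derive_Reals. apply is_derive_Reals in H1, H2.
    assert (T := derivable_pt_lim_comp_2d _ _ _ _ _ _ _ _ G2 H1 H2).
    intros eps Heps; destruct (T eps Heps) as [delta Hd]; exists delta.
    intros r Hr0 Hr; specialize (Hd r Hr0 Hr). rewrite <- !surjective_pairing in Hd. exact Hd. }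
  set (x1 := fst d * s1 + - snd d * s2) in *. set (y1 := snd d * s1 + fst d * s2) in *.
  destruct A as [a1 a2].
  exists (height_dx a1 a2 (x t) (y t) * x1 + height_dx a2 a1 (y t) (x t) * y1). split.
  - apply is_derive_ext with (fun t => 
      ((1 - (a1 ^ 2 + a2 ^ 2)) * (1 - (x t ^ 2 + y t ^ 2)) + 4 * (a1 * x t + a2 * y t))
      / ((1 + (a1 ^ 2 + a2 ^ 2)) * (1 + (x t ^ 2 + y t ^ 2)))).
    { intros s. unfold height; rewrite !Cmod2_alt; reflexivity. }
    assert (0 < 1 + (a1 ^ 2 + a2 ^ 2)) by nra.
    assert (0 < 1 + (x t ^ 2 + y t ^ 2)) by nra.
    auto_derive.
    + repeat split; try (eexists; first [exact Hx | exact Hy]).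
      apply Rgt_not_eq, Rmult_lt_0_compat; nra.
    + assert (Ex : Derive (fun s : R => x s) t = x1) by (apply is_derive_unique; exact Hx).
      assert (Ey : Derive (fun s : R => y s) t = y1) by (apply is_derive_unique; exact Hy).
      rewrite Ex, Ey.
      unfold height_dx. field. split; nra.
  - assert (E := height_gradient a1 a2 (x t) (y t)).
    replace (x t, y t) with (k (sigma t)) in E by (unfold x, y; apply surjective_pairing).
    set (H := height (a1, a2) (k (sigma t))) in *.
    set (hx := height_dx a1 a2 (x t) (y t)) in *. set (hy := height_dx a2 a1 (y t) (x t)) in *.
    apply Rle_trans with ((hx ^ 2 + hy ^ 2) * (x1 ^ 2 + y1 ^ 2)).
    + assert (0 <= (hx * y1 - hy * x1) ^ 2) by apply pow2_ge_0. lra.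
    + replace (x1 ^ 2 + y1 ^ 2) with (Cmod d ^ 2 * Cmod (s1, s2) ^ 2)
        by (rewrite !Cmod2_alt; unfold Re, Im, x1, y1; simpl; ring).
      rewrite E.
      replace (x t ^ 2 + y t ^ 2) with (Cmod (k (sigma t)) ^ 2)
        by (rewrite Cmod2_alt; reflexivity).
      replace (Cmod d) with (rho * (1 + Cmod (k (sigma t)) ^ 2) / 2) by lra.
      right; field. generalize (pow2_ge_0 (Cmod (k (sigma t)))); lra.
Qed.

(** The isometry [w -> 1 / w] of the sphere exchanges [A] with [1 / A], whose
    antipode is [- conj A]. *)
Lemma height_inversion (A w : C) : w <> RtoC 0 ->
  height A w = - height (- Cconj A)%C (/ (w - 0))%C.
Proof.
  intros Hw. unfold height. assert (Hp := sqdist_pos _ _ Hw).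
  rewrite !Cmod2_alt. destruct A as [a1 a2], w as [x y].
  unfold sqdist in Hp. simpl in *. 
  assert (0 < 1 + (a1 ^ 2 + a2 ^ 2)) by nra. assert (0 < 1 + (x ^ 2 + y ^ 2)) by nra.
  assert (0 < x ^ 2 + y ^ 2) by nra.
  field. repeat split; try nra.
Qed.

Lemma cosine_inv_chart (f : C -> option C) (A z : C) : f z <> Some (RtoC 0) ->
  cosine f A z = - height (- Cconj A)%C (inv_chart f (RtoC 0) z).
Proof.
  intros H. unfold cosine, inv_chart. destruct (f z) as [w|].
  - apply height_inversion. congruence.
  - unfold height. rewrite Cmod_opp, Cmod_conj, Cmod_0. simpl fst; simpl snd.
    field. generalize (pow2_ge_0 (Cmod A)); lra.
Qed.

Lemma cosine_bound (f : C -> option C) (A z : C) : cosine f A z ^ 2 <= 1.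
Proof.
  destruct (f z) as [w|] eqn:E.
  - unfold cosine; rewrite E. apply height_bound.
  - rewrite cosine_inv_chart by congruence.
    replace ((- _) ^ 2) with (height (- Cconj A)%C (inv_chart f (RtoC 0) z) ^ 2) by ring.
    apply height_bound.
Qed.

Lemma curve_near (sigma : R -> C) (t s1 s2 rho : R) :
  is_derive (fun t => fst (sigma t)) t s1 ->
  is_derive (fun t => snd (sigma t)) t s2 -> 0 < rho ->
  locally t (fun s => Cmod (sigma s - sigma t) < rho).
Proof.
  intros H1 H2 Hrho.
  assert (C1 : continuous (fun t => fst (sigma t)) t)
    by (apply (ex_derive_continuous (V := R_NormedModule)); eexists; exact H1).
  assert (C2 : continuous (fun t => snd (sigma t)) t)
    by (apply (ex_derive_continuous (V := R_NormedModule)); eexists; exact H2).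
  assert (Hr4 : 0 < rho / 4) by lra.
  assert (N1 := proj1 (filterlim_locally _ _) C1 (mkposreal _ Hr4)).
  assert (N2 := proj1 (filterlim_locally _ _) C2 (mkposreal _ Hr4)).
  generalize (filter_and _ _ N1 N2). apply filter_imp. intros s [K1 K2].
  eapply Rle_lt_trans; [apply Cmod_le_2Rmax|].
  apply Rle_lt_trans with (2 * (rho / 4)); [|lra].
  apply Rmult_le_compat_l; [lra|]. left; apply Rmax_lub_lt; [exact K1 | exact K2].
Qed.

Lemma cosine_along_curve (u : C -> R) (f : C -> option C) (A : C) (sigma : R -> C) (t s1 s2 : R) :
  smooth2 u -> developing_function u f ->
  is_derive (fun t => fst (sigma t)) t s1 ->
  is_derive (fun t => snd (sigma t)) t s2 ->
  exists l : R, is_derive (fun t => cosine f A (sigma t)) t l /\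
    l ^ 2 <= (1 - cosine f A (sigma t) ^ 2) * (exp (u (sigma t)) * Cmod (s1, s2)) ^ 2.
Proof.
  intros Hsm Hdev H1 H2. set (z := sigma t).
  destruct (f z) as [w|] eqn:Ez.
  - assert (Hfin : f z <> None) by congruence.
    destruct Hdev as (Hm & _ & H0 & Hu).
    destruct (finite_part_derive f z Hm Hfin) as (Hd & r & Hr & Hnear).
    assert (Hcos : forall y, f y <> None -> height A (finite_part f y) = cosine f A y).
    { intros y Hy. unfold finite_part, cosine. destruct (f y); [reflexivity | congruence]. }
    destruct (height_along_curve A (finite_part f) sigma t s1 s2 (exp (u z)) _ Hd)
      as (l & Hl & Hb); trivial.
    { fold z. rewrite (Hu z Hfin). specialize (H0 z Hfin). apply Cmod_gt_0 in H0.
      assert (P := pow2_ge_0 (Cmod (finite_part f z))).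
      rewrite exp_ln by (apply Rdiv_lt_0_compat; lra). field; lra. }
    exists l; split.
    + eapply is_derive_ext_loc; [|exact Hl].
      generalize (curve_near sigma t s1 s2 r H1 H2 Hr). apply filter_imp.
      intros s Hs; apply Hcos, Hnear, Hs.
    + rewrite <- (Hcos z) by exact Hfin. exact Hb.
  - assert (Hne : f z <> Some (RtoC 0)) by congruence.
    destruct (inv_chart_metric u f (RtoC 0) z Hsm Hdev Hne) as (d & Hd & E).
    assert (Hsp : simple_pole_at f z).
    { destruct Hdev as (Hm & Hp & _). apply Hp. destruct (Hm z) as [H|H]; trivial.
      apply locally_singleton in H. destruct H; congruence. }
    destruct (inv_chart_pole f (RtoC 0) z Hsp) as (_ & rho & Hrho & Hnear).
    destruct (height_along_curve (- Cconj A)%C (inv_chart f (RtoC 0)) sigma t s1 s2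
       (exp (u z)) d Hd) as (l & Hl & Hb); trivial.
    { rewrite <- E. f_equal. unfold inv_chart_density. rewrite Cmod_0.
      fold z. rewrite !Cmod2_alt. unfold sqdist, Re, Im. simpl. field. }
    exists (- l); split.
    + apply is_derive_ext_loc with
        (fun s => - height (- Cconj A)%C (inv_chart f (RtoC 0) (sigma s))).
      * generalize (curve_near sigma t s1 s2 rho H1 H2 Hrho). apply filter_imp.
        intros s Hs. symmetry; apply cosine_inv_chart.
        destruct (Req_dec (Cmod (sigma s - sigma t)) 0) as [E0|E0].
        -- apply Cmod_eq_0 in E0.
           replace (sigma s) with z; trivial. unfold z.
           replace (sigma s) with (sigma s - sigma t + sigma t)%C by ring. rewrite E0; ring.
        -- apply Hnear. fold z in Hs, E0 |- *. generalize (Cmod_ge_0 (sigma s - z)); lra.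
      * apply (is_derive_opp (V := R_NormedModule)). exact Hl.
    + fold z in Hb. rewrite cosine_inv_chart by exact Hne.
      replace ((- l) ^ 2) with (l ^ 2) by ring.
      replace ((- height (- Cconj A)%C (inv_chart f (RtoC 0) z)) ^ 2)
        with (height (- Cconj A)%C (inv_chart f (RtoC 0) z) ^ 2) by ring.
      exact Hb.
Qed.

Lemma is_derive_asin (x : R) : -1 < x < 1 -> is_derive asin x (/ sqrt (1 - x ^ 2)).
Proof.
  intros Hx. apply is_derive_Reals.
  replace (/ sqrt (1 - x ^ 2)) with (derive_pt asin x (derivable_pt_asin x Hx)).
  - apply derive_pt_eq with (pr := derivable_pt_asin x Hx). reflexivity.
  - rewrite derive_pt_asin. unfold Rdiv; rewrite Rmult_1_l.
    replace (Rsqr x) with (x ^ 2) by (unfold Rsqr; ring). reflexivity.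
Qed.

(** The factor [kappa < 1] keeps the argument inside the interval where [asin] is
    differentiable. *)
Definition damped_angle (f : C -> option C) (A : C) (kappa : R) (z : C) : R :=
  asin (kappa * cosine f A z).

(** With [c] the cosine, the derivative of [asin (kappa c)] is at most
    [kappa sqrt (1 - c^2) / sqrt (1 - kappa^2 c^2)] times the conformal speed,
    and the fraction is at most 1. *)
Lemma damped_angle_speed (u : C -> R) (f : C -> option C) (A : C) (kappa : R)
    (sigma : R -> C) (t s1 s2 : R) :
  0 < kappa < 1 -> smooth2 u -> developing_function u f ->
  is_derive (fun t => fst (sigma t)) t s1 ->
  is_derive (fun t => snd (sigma t)) t s2 ->
  exists l : R, is_derive (fun t => damped_angle f A kappa (sigma t)) t l /\
    Rabs l <= exp (u (sigma t)) * Cmod (s1, s2).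
Proof.
  intros Hk Hsm Hdev H1 H2.
  destruct (cosine_along_curve u f A sigma t s1 s2 Hsm Hdev H1 H2) as (l & Hl & Hb).
  set (c := cosine f A (sigma t)) in *. set (J := exp (u (sigma t)) * Cmod (s1, s2)) in *.
  assert (Hc : c ^ 2 <= 1) by apply cosine_bound.
  assert (HJ : 0 <= J) by (apply Rmult_le_pos; [left; apply exp_pos | apply Cmod_ge_0]).
  assert (Hc1 : -1 <= c <= 1) by nra.
  assert (Hkc : -1 < kappa * c < 1) by nra.
  assert (Hpos : 0 < 1 - (kappa * c) ^ 2) by nra.
  exists (kappa * l * / sqrt (1 - (kappa * c) ^ 2)); split.
  - apply (is_derive_comp asin (fun t => kappa * cosine f A (sigma t))).
    + apply is_derive_asin, Hkc.
    + apply (is_derive_scal (fun t => cosine f A (sigma t)) t kappa l). exact Hl.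
  - assert (Hs : 0 < sqrt (1 - (kappa * c) ^ 2)) by (apply sqrt_lt_R0, Hpos).
    rewrite Rabs_mult, (Rabs_pos_eq (/ _)) by (left; apply Rinv_0_lt_compat, Hs).
    apply Rmult_le_reg_r with (sqrt (1 - (kappa * c) ^ 2)); trivial.
    rewrite Rmult_assoc, Rinv_l, Rmult_1_r by lra.
    apply Rsqr_incr_0; [|apply Rabs_pos | apply Rmult_le_pos; lra].
    rewrite <- Rsqr_abs, Rsqr_mult, (Rsqr_mult J), Rsqr_sqrt by lra.
    rewrite !Rsqr_pow2.
    apply Rle_trans with (kappa ^ 2 * ((1 - c ^ 2) * J ^ 2)).
    + apply Rmult_le_compat_l; [apply pow2_ge_0 | exact Hb].
    + assert (0 <= J ^ 2) by apply pow2_ge_0.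
      replace (kappa ^ 2 * ((1 - c ^ 2) * J ^ 2)) with (J ^ 2 * (kappa ^ 2 * (1 - c ^ 2))) by ring.
      apply Rmult_le_compat_l; trivial. nra.
Qed.

Lemma smooth_curve_derive (sigma : R -> C) : smooth_curve sigma -> forall t,
  is_derive (fun t => fst (sigma t)) t (Derive (fun t => fst (sigma t)) t) /\
  is_derive (fun t => snd (sigma t)) t (Derive (fun t => snd (sigma t)) t) /\
  continuous (Derive (fun t => fst (sigma t))) t /\
  continuous (Derive (fun t => snd (sigma t))) t.
Proof.
  intros H t. destruct (H 1%nat t) as [E1 E2]. destruct (H 2%nat t) as [E3 E4].
  split; [|split; [|split]].
  - apply Derive_correct, E1.
  - apply Derive_correct, E2.
  - apply (ex_derive_continuous (V := R_NormedModule)), E3.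
  - apply (ex_derive_continuous (V := R_NormedModule)), E4.
Qed.

Lemma continuous_Cmod_pair (f g : R -> R) (t : R) :
  continuous f t -> continuous g t -> continuous (fun t => Cmod (f t, g t)) t.
Proof.
  intros Hf Hg. unfold Cmod; simpl fst; simpl snd.
  apply continuous_sqrt_comp.
  apply (continuous_plus (V := R_NormedModule)).
  - apply (continuous_comp f (fun s => s ^ 2)); trivial.
    apply (ex_derive_continuous (V := R_NormedModule)); auto_derive; trivial.
  - apply (continuous_comp g (fun s => s ^ 2)); trivial.
    apply (ex_derive_continuous (V := R_NormedModule)); auto_derive; trivial.
Qed.

(** The sum of the damped angle and the length run through so far is
    nondecreasing. *)
Lemma smooth_piece_length (u : C -> R) (f : C -> option C) (A : C) (kappa : R)
    (sigma : R -> C) (a b : R) :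
  0 < kappa < 1 -> smooth2 u -> developing_function u f -> smooth_curve sigma -> a < b ->
  ex_RInt (fun t => exp (u (sigma t)) * speed sigma t) a b /\
  damped_angle f A kappa (sigma a) - damped_angle f A kappa (sigma b) <=
    RInt (fun t => exp (u (sigma t)) * speed sigma t) a b.
Proof.
  intros Hk Hsm Hdev Hsig Hab.
  set (J := fun t => exp (u (sigma t)) * speed sigma t).
  assert (HJ : forall t, continuous J t).
  { intros t. destruct (smooth_curve_derive sigma Hsig t) as (D1 & D2 & C1 & C2).
    apply (continuous_mult (K := R_AbsRing)).
    - apply (continuous_comp (fun t => u (sigma t)) exp); [|apply continuous_exp].
      assert (Hu : continuity_2d_pt (fun x y => u (x, y)) (fst (sigma t)) (snd (sigma t)))
        by apply (Hsm 0%nat).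
      apply continuity_2d_pt_filterlim in Hu.
      apply (continuous_ext (fun t => (fun x y => u (x, y)) (fst (sigma t)) (snd (sigma t)))).
      + intros s; rewrite <- surjective_pairing; reflexivity.
      + apply (continuous_comp_2 (fun t => fst (sigma t)) (fun t => snd (sigma t)) (fun x y => u (x, y)));
          trivial; apply (ex_derive_continuous (V := R_NormedModule)); eexists; eassumption.
    - apply continuous_Cmod_pair; trivial. }
  assert (HI : forall x y, ex_RInt J x y).
  { intros x y; apply (ex_RInt_continuous (V := R_CompleteNormedModule)); intros; apply HJ. }
  split; [apply HI|].
  set (G := fun t => damped_angle f A kappa (sigma t)).
  assert (HG : forall t, exists l, is_derive G t l /\ Rabs l <= J t).
  { intros t. destruct (smooth_curve_derive sigma Hsig t) as (D1 & D2 & _ & _).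
    exact (damped_angle_speed u f A kappa sigma t _ _ Hk Hsm Hdev D1 D2). }
  assert (HG' : forall t, is_derive G t (Derive G t) /\ Rabs (Derive G t) <= J t).
  { intros t; destruct (HG t) as (l & Hl & Hb). rewrite (is_derive_unique _ _ _ Hl); tauto. }
  assert (HT : forall t, is_derive (fun t => G t + RInt J a t) t (Derive G t + J t)).
  { intros t. apply (is_derive_plus (V := R_NormedModule) G (fun t => RInt J a t)).
    - apply HG'.
    - apply (is_derive_RInt (V := R_NormedModule) J (fun t => RInt J a t) a); [|apply HJ].
      apply filter_forall. intros s. apply (RInt_correct (V := R_CompleteNormedModule)), HI. }
  destruct (MVT_gen (fun t => G t + RInt J a t) a b (fun t => Derive G t + J t))
    as (c & _ & Ec).
  - intros t _; apply HT.
  - intros t _. apply continuity_pt_filterlim.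
    apply (ex_derive_continuous (V := R_NormedModule) (fun t => G t + RInt J a t)).
    eexists; apply HT.
  - cbv beta in Ec. rewrite RInt_point in Ec. unfold zero in Ec; simpl in Ec.
    destruct (HG' c) as [_ Hb]. apply Rabs_le_between in Hb.
    assert (0 <= (Derive G c + J c) * (b - a)) by (apply Rmult_le_pos; lra).
    fold (G a) (G b). lra.
Qed.

Lemma curve_length (u : C -> R) (f : C -> option C) (A : C) (kappa : R)
    (gamma : R -> C) (a b : R) :
  0 < kappa < 1 -> smooth2 u -> developing_function u f -> piecewise_smooth gamma a b ->
  damped_angle f A kappa (gamma a) - damped_angle f A kappa (gamma b) <=
    conformal_length u gamma a b.
Proof.
  intros Hk Hsm Hdev (n & tau & Ha & Hb & Hpieces).
  set (I := fun t => exp (u (gamma t)) * speed gamma t).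
  assert (H : forall m, (m <= n)%nat -> ex_RInt I (tau 0%nat) (tau m) /\
     damped_angle f A kappa (gamma (tau 0%nat)) - damped_angle f A kappa (gamma (tau m))
       <= RInt I (tau 0%nat) (tau m)).
  { induction m as [|m IH]; intros Hm.
    - split; [apply ex_RInt_point|]. rewrite RInt_point. unfold zero; simpl. lra.
    - destruct (IH ltac:(lia)) as [I1 L1].
      destruct (Hpieces m ltac:(lia)) as (Hlt & sigma & Hsig & Heq).
      destruct (smooth_piece_length u f A kappa sigma (tau m) (tau (S m)) Hk Hsm Hdev Hsig Hlt)
        as [I2 L2].
      rewrite <- !Heq in L2 by lra.
      (* On the open piece [gamma] agrees with [sigma] near each point, so the two
         speeds agree; the breakpoints do not change the integral. *)
      assert (HE : forall t, Rmin (tau m) (tau (S m)) < t < Rmax (tau m) (tau (S m)) ->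
         exp (u (sigma t)) * speed sigma t = I t).
      { intros t Ht. rewrite Rmin_left, Rmax_right in Ht by lra.
        unfold I. rewrite Heq by lra. f_equal. unfold speed.
        assert (Hloc : locally t (fun s => sigma s = gamma s)).
        { apply filter_imp with (fun s => tau m < s < tau (S m)).
          - intros s Hs; symmetry; apply Heq; lra.
          - apply (open_and (fun s => tau m < s) (fun s => s < tau (S m)));
              [apply open_gt | apply open_lt | exact Ht]. }
        assert (D1 : Derive (fun s : R => fst (sigma s)) t = Derive (fun s : R => fst (gamma s)) t).
        { apply Derive_ext_loc; revert Hloc; apply filter_imp; intros s Hs; rewrite Hs; reflexivity. }
        assert (D2 : Derive (fun s : R => snd (sigma s)) t = Derive (fun s : R => snd (gamma s)) t).
        { apply Derive_ext_loc; revert Hloc; apply filter_imp; intros s Hs; rewrite Hs; reflexivity. }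
        rewrite D1, D2; reflexivity. }
      assert (I2' : ex_RInt I (tau m) (tau (S m))) by (apply (ex_RInt_ext _ _ _ _ HE I2)).
      rewrite (RInt_ext _ _ _ _ HE) in L2.
      split; [apply (ex_RInt_Chasles _ _ _ _ I1 I2')|].
      rewrite <- (RInt_Chasles I _ _ _ I1 I2'). unfold plus; simpl. lra. }
  destruct (H n (Nat.le_refl n)) as [_ L]. rewrite Ha, Hb in L. exact L.
Qed.

(** With [kappa = sin (PI / 2 - eta)] the damped angle falls from
    [PI / 2 - eta] to [- (PI / 2 - eta)]. *)
Lemma length_ge_PI (u : C -> R) (f : C -> option C) (A : C) (gamma : R -> C) (a b : R) :
  smooth2 u -> developing_function u f -> piecewise_smooth gamma a b ->
  cosine f A (gamma a) = 1 -> cosine f A (gamma b) = -1 ->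
  PI <= conformal_length u gamma a b.
Proof.
  intros Hsm Hdev Hg Ca Cb.
  generalize PI_RGT_0; intros Hpi.
  apply Rnot_lt_le; intros Hlt.
  set (L := conformal_length u gamma a b) in *.
  set (eta := Rmin (PI / 4) ((PI - L) / 4)).
  assert (E1 := Rmin_l (PI / 4) ((PI - L) / 4)). assert (E2 := Rmin_r (PI / 4) ((PI - L) / 4)).
  fold eta in E1, E2.
  assert (Heta : 0 < eta) by (apply Rmin_glb_lt; lra).
  assert (Hk : 0 < sin (PI / 2 - eta) < 1).
  { split; [apply sin_gt_0; lra|]. rewrite <- sin_PI2. apply sin_increasing_1; lra. }
  assert (HL := curve_length u f A _ gamma a b Hk Hsm Hdev Hg). fold L in HL.
  unfold damped_angle in HL. rewrite Ca, Cb in HL.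
  rewrite Rmult_1_r in HL.
  replace (sin (PI / 2 - eta) * -1) with (sin (- (PI / 2 - eta))) in HL by (rewrite sin_neg; ring).
  rewrite !asin_sin in HL by lra. lra.
Qed.

Lemma affine_smooth (p q : R) (n : nat) (t : R) : ex_derive_n (fun s => p + s * q) n t.
Proof.
  assert (H : forall n, exists a b, forall t, Derive_n (fun s => p + s * q) n t = a + t * b).
  { induction n0 as [|m (a & b & IH)].
    - exists p, q; reflexivity.
    - exists b, 0. intros s. simpl. rewrite (Derive_ext _ (fun t => a + t * b) s IH).
      apply is_derive_unique. auto_derive; trivial; ring. }
  destruct n as [|m]; [exact I|]. destruct (H m) as (a & b & E).
  simpl. apply ex_derive_ext with (fun t => a + t * b).
  - intros s; symmetry; apply E.
  - auto_derive; trivial.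
Qed.

Lemma segment_piecewise_smooth (P Q : C) :
  piecewise_smooth (fun t => (fst P + t * (fst Q - fst P), snd P + t * (snd Q - snd P))) 0 1.
Proof.
  exists 1%nat, INR; repeat split.
  - replace i with 0%nat by lia. simpl; lra.
  - eexists; split; [|intros; reflexivity].
    intros n t; split; apply affine_smooth.
Qed.

(** As [conformal_dist] sends an infinite infimum to [0], a curve from [P] to [Q]
    has to be exhibited: the straight segment. *)
Lemma conformal_dist_antipodal (u : C -> R) (f : C -> option C) (A P Q : C) :
  smooth2 u -> developing_function u f ->
  cosine f A P = 1 -> cosine f A Q = -1 -> conformal_dist u P Q >= PI.
Proof.
  intros Hsm Hdev HP HQ. unfold conformal_dist.
  match goal with |- real (Glb_Rbar ?E) >= _ => set (S := E) end.
  destruct (Glb_Rbar_correct S) as [Hlb Hglb].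
  assert (HS : Rbar_le PI (Glb_Rbar S)).
  { apply Hglb. intros L (gamma & a & b & _ & Hg & Ga & Gb & ->). simpl.
    apply (length_ge_PI u f A); trivial; congruence. }
  assert (Hex : exists L, S L).
  { eexists; exists (fun t => (fst P + t * (fst Q - fst P), snd P + t * (snd Q - snd P))), 0, 1.
    repeat split; try lra.
    - apply segment_piecewise_smooth.
    - apply injective_projections; simpl; ring.
    - apply injective_projections; simpl; ring. }
  destruct Hex as (L & HL). specialize (Hlb L HL).
  destruct (Glb_Rbar S); simpl in *; try contradiction. lra.
Qed.

(** * Counting the exceptional points *)

Definition antipode (A : C) : C := (- / Cconj A)%C.

Lemma cosine_self (f : C -> option C) (A P : C) : f P = Some A -> cosine f A P = 1.
Proof.
  intros E; unfold cosine; rewrite E. unfold height. rewrite Cmod2_alt.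
  destruct A as [a1 a2]; unfold Re, Im; simpl.
  field. nra.
Qed.

Lemma cosine_antipode (f : C -> option C) (A Q : C) :
  A <> 0 -> f Q = Some (antipode A) -> cosine f A Q = -1.
Proof.
  intros HA E; unfold cosine; rewrite E. unfold height, antipode. rewrite !Cmod2_alt.
  assert (Hp := sqdist_pos _ _ HA). destruct A as [a1 a2]. unfold sqdist in Hp. simpl in *.
  field. repeat split; nra.
Qed.

Theorem proposition2p2 :
  forall (u : C -> R) (f : C -> option C),
    smooth2 u ->
    (forall z : C, laplacian u z + exp (2 * u z) = 0) ->
    developing_function u f ->
    exists E : C -> Prop,
      Rbar_le (H0 (fun z => ~ E z)) (Finite 5) /\
      forall A : C, E A ->
        exists P Q : C, f P = Some A /\ conformal_dist u P Q >= PI.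
Proof.
  intros u f Hsm Heq Hdev.
  set (E := fun A : C => exists P Q : C, f P = Some A /\ conformal_dist u P Q >= PI).
  exists E; split; [|trivial].
  set (omitted := fun A : C => forall z, f z <> Some A).
  assert (Hbad : forall A, ~ E A -> A = RtoC 0 \/ omitted A \/ omitted (antipode A)).
  { intros A HA. apply NNPP; intros Hn. apply HA.
    assert (A0 : A <> RtoC 0) by tauto.
    assert (H1 : ~ omitted A) by tauto. assert (H2 : ~ omitted (antipode A)) by tauto.
    apply not_all_ex_not in H1. destruct H1 as [P HP]. apply NNPP in HP.
    apply not_all_ex_not in H2. destruct H2 as [Q HQ]. apply NNPP in HQ.
    exists P, Q; split; trivial.
    apply (conformal_dist_antipodal u f A); trivial.
    - apply cosine_self, HP.
    - apply cosine_antipode; trivial. }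
  assert (Htwo : exists a b, forall c, omitted c -> c = a \/ c = b).
  { destruct (classic (exists a b, a <> b /\ omitted a /\ omitted b))
      as [(a & b & Hab & Ha & Hb)|Hn].
    - exists a, b. intros c Hc. apply NNPP; intros Hne.
      apply (picard_three_values u f a b c Hsm Heq Hdev); trivial; intros Hac; apply Hne; auto.
    - destruct (classic (exists a, omitted a)) as [[a Ha]|Hn'].
      + exists a, a. intros c Hc. apply NNPP; intros Hne.
        apply Hn; exists a, c; repeat split; trivial. intros Hac; apply Hne; auto.
      + exists (RtoC 0), (RtoC 0). intros c Hc. exfalso; apply Hn'; exists c; exact Hc. }
  destruct Htwo as (a & b & Hab).
  assert (Hanti : forall A, A <> RtoC 0 -> A = antipode (antipode A)).
  { intros A HA. assert (Hp := sqdist_pos _ _ HA). unfold antipode.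
    destruct A as [a1 a2]. unfold sqdist in Hp. simpl in Hp.
    apply injective_projections; simpl; field; repeat split; nra. }
  unfold H0. apply Lub_Rbar_correct.
  intros r (l & Hnd & Hl & ->). simpl.
  replace 5 with (INR 5) by (simpl; ring).
  apply le_INR.
  change 5%nat with (length (RtoC 0 :: a :: b :: antipode a :: antipode b :: nil)).
  apply NoDup_incl_length; trivial.
  intros A HA. specialize (Hl A HA).
  destruct (classic (A = RtoC 0)) as [->|A0]; [left; reflexivity|].
  destruct (Hbad A Hl) as [H|[H|H]]; [contradiction| |].
  - destruct (Hab _ H) as [-> | ->]; simpl; auto 7.
  - rewrite (Hanti A A0). destruct (Hab _ H) as [-> | ->]; simpl; auto 7.
Qed.
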